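(* Let $n,d\ge 1$, $0<\mu\le L$, and let $f_1,\dots,f_n,f_s,g:\mathbb{R}^d\to\mathbb{R}$ be $L$-smooth and $\mu$-strongly convex. Let $x^\star$ be the unique minimizer of $\frac1n\sum_{i=1}^n f_i(x)+2f_s(x)+g(x)$ over $\mathbb{R}^d$. Consider the algorithm BiCoLoR described in the context, with sparsification level $k\in\{1,\dots,d\}$ and compressors satisfying the compressor assumption of the context with constants $\omega,\omega_s,\omega_{\mathrm{av}}\ge 0$. Suppose that $0<\gamma<\frac{2}{L}$, that $p_t\equiv p\in(0,1]$ is constant, and that $$\rho=\rho_y=\frac{1}{2+\omega_{\mathrm{av}}+2\omega_s},\qquad \eta=\eta_y=\frac{1}{(1+2\omega+2\omega_s)(2+\omega_{\mathrm{av}}+2\omega_s)}.$$ Let $u_y^\star:=\nabla g(x^\star)$ and $u_i^\star:=\nabla f_i(x^\star)$ for $i\in\{1,\dots,n\}$, and for every $t\ge 0$ define $$\Psi^t:=\frac1\gamma\left(\sum_{i=1}^n\|x_i^t-x^\star\|^2+2n\|x_s^t-x^\star\|^2+n\|y^t-x^\star\|^2\right)+\frac{d^2\gamma}{p^2k^2\eta}\left(\sum_{i=1}^n\|u_i^t-u_i^\star\|^2+n\|u_y^t-u_y^\star\|^2\right).$$ Then for every $t\ge 0$, $$\mathbb{E}[\Psi^t]\le c^t\,\Psi^0,\qquad\text{where}\quad c:=\max\left((1-\gamma\mu)^2,(1-\gamma L)^2,1-\frac{p^2k^2\eta}{d^2}\right)<1.$$ In addition, almost surely as $t\to\infty$: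 $x_i^t\to x^\star$ for every $i\in\{1,\dots,n\}$, $x_s^t\to x^\star$, $y^t\to x^\star$, $u_i^t\to u_i^\star$ for every $i\in\{1,\dots,n\}$, and $u_y^t\to u_y^\star$.
   Context: Norms and inner products are Euclidean; $[d]:=\{1,\dots,d\}$. A differentiable function is $L$-smooth if its gradient is $L$-Lipschitz; $\phi$ is $\mu$-strongly convex if $\phi-\frac\mu2\|\cdot\|^2$ is convex. Compressors. For $\omega\ge0$, $\mathbb{U}(\omega)$ is the set of random maps $\mathcal{C}:\mathbb{R}^d\to\mathbb{R}^d$ with $\mathbb{E}[\mathcal{C}(x)]=x$ and $\mathbb{E}\|\mathcal{C}(x)-x\|^2\le\omega\|x\|^2$ for every $x\in\mathbb{R}^d$. For $x\in\mathbb{R}^d$ and $\Omega\subset[d]$, $x_\Omega\in\mathbb{R}^d$ is $x$ with the coordinates outside $\Omega$ set to zero. $\mathcal{C}_\Omega$ denotes the compressor $\mathcal{C}$ applied only to the coordinates in $\Omega$: it maps vectors supported in $\Omega$ to random vectors supported in $\Omega$, with the same unbiasedness and variance bounds (with the same constants) on such vectors; $\mathcal{C}_{[d]}=\mathcal{C}$. Compressor assumption. For every $t\ge0$ and $i\in[n]$: $\mathcal{C}_i^t\in\mathbb{U}(\omega)$ and $\mathcal{C}_s^t\in\mathbb{U}(\omega_s)$. The families $(\mathcal{C}_1^t,\dots,\mathcal{C}_n^t,\mathcal{C}_s^t)$ are independent for different $t$, and independent of all coin flips and subset choices below. For each $t$, $\mathcal{C}_s^t$ is independent of $(\mathcal{C}_i^t)_{i=1}^n$.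 The $(\mathcal{C}_i^t)_{i=1}^n$ need not be mutually independent; $\omega_{\mathrm{av}}\ge0$ is a constant such that for every $t$ and every $(x_i)_{i=1}^n\in(\mathbb{R}^d)^n$, $$\mathbb{E}\left\|\frac1n\sum_{i=1}^n(\mathcal{C}_i^t(x_i)-x_i)\right\|^2\le\frac{\omega_{\mathrm{av}}}{n}\sum_{i=1}^n\|x_i\|^2$$ (and likewise for the restricted compressors $\mathcal{C}^t_{i,\Omega}$ on vectors supported in $\Omega$). Algorithm BiCoLoR. Parameters: $\gamma,\eta,\eta_y,\rho,\rho_y>0$, probabilities $(p_t)_{t\ge1}$ in $(0,1]$, $k\in[d]$. Deterministic initialization: $x_1^0,\dots,x_n^0,x_s^0,y^0\in\mathbb{R}^d$ arbitrary, and $u_1^0,\dots,u_n^0,u_s^0,u_y^0\in\mathbb{R}^d$ with $\frac1n\sum_{i=1}^nu_i^0+2u_s^0+u_y^0=0$. For $t=0,1,\dots$: 1. $\hat x_i^t:=x_i^t-\gamma\nabla f_i(x_i^t)+\gamma u_i^t$ for $i\in\{1,\dots,n,s\}$, and $\hat y^t:=y^t-\gamma\nabla g(y^t)+\gamma u_y^t$. 2. Draw $\theta^t\in\{0,1\}$ with $\mathrm{Prob}(\theta^t=1)=p_{t+1}$ (independently of everything else). 3. If $\theta^t=1$ (a communication round): draw $\Omega^t\subset[d]$ of size $k$ uniformly at random (independently). Set $c_i^t:=\mathcal{C}^t_{i,\Omega^t}(\hat x^t_{i,\Omega^t}-\hat y^t_{\Omega^t})$ for $i\in[n]$, $c_s^t:=\mathcal{C}^t_{s,\Omega^t}(\hat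 x^t_{s,\Omega^t}-\hat y^t_{\Omega^t})$, $\bar c^t:=\frac1n\sum_{i=1}^nc_i^t$. On the coordinates in $\Omega^t$, for $i\in[n]$, $$x^{t+1}_{i,\Omega^t}:=(1-\rho)\hat x^t_{i,\Omega^t}+\rho(c_s^t+\hat y^t_{\Omega^t}),\qquad x^{t+1}_{s,\Omega^t}:=\Big(1-\tfrac{\rho+\rho_y}{2}\Big)\hat x^t_{s,\Omega^t}+\tfrac{\rho+\rho_y}{2}\hat y^t_{\Omega^t}+\tfrac\rho2\bar c^t,$$ while on the coordinates outside $\Omega^t$, $x_i^{t+1}$ and $x_s^{t+1}$ coincide with $\hat x_i^t$ and $\hat x_s^t$. Moreover $y^{t+1}:=\hat y^t+\rho_yc_s^t$, and $$u_i^{t+1}:=u_i^t-\tfrac{p_{t+1}k\eta}{d\gamma}(c_i^t-c_s^t)\ (i\in[n]),\quad u_y^{t+1}:=u_y^t+\tfrac{p_{t+1}k\eta_y}{d\gamma}c_s^t,\quad u_s^{t+1}:=u_s^t+\tfrac{p_{t+1}k\eta}{2d\gamma}\bar c^t-\tfrac{p_{t+1}k(\eta_y+\eta)}{2d\gamma}c_s^t.$$ 4. If $\theta^t=0$: $x_i^{t+1}:=\hat x_i^t$, $u_i^{t+1}:=u_i^t$ for $i\in\{1,\dots,n,s\}$, $y^{t+1}:=\hat y^t$, $u_y^{t+1}:=u_y^t$. *)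

(* Defs.v *)
From HB Require Import structures.
From mathcomp Require Import all_boot all_order all_algebra.
From mathcomp Require Import all_classical all_reals all_analysis.

Set Implicit Arguments.
Unset Strict Implicit.
Unset Printing Implicit Defensive.

Import Order.TTheory GRing.Theory Num.Theory.
Import numFieldNormedType.Exports.

Local Open Scope classical_set_scope.
Local Open Scope ring_scope.

Section Euclidean.
Context {R : realType} {d : nat}.
Implicit Types (x z : 'rV[R]_d) (A : {set 'I_d}) (f : 'rV[R]_d -> R).

(* The library norm `|x| on 'rV[R]_d is the sup norm, hence an explicit
   Euclidean norm; both induce the same topology and differentiability. *)
Definition sqnorm x : R := \sum_(j < d) x ord0 j ^+ 2.
Definition enorm x : R := Num.sqrt (sqnorm x).

Definition gradient f x : 'rV[R]_d := \row_(j < d) 'D_(delta_mx ord0 j) f x.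

Definition smooth (L : R) f : Prop :=
  (forall x, differentiable f x) /\
  (forall x z, enorm (gradient f x - gradient f z) <= L * enorm (x - z)).

Definition strongly_convex (mu : R) f : Prop :=
  convex_function [set: convex_lmodType 'rV[R]_d]
    (fun x => f x - mu / 2 * sqnorm x).

Definition restrict_coords A x : 'rV[R]_d :=
  \row_(j < d) (if j \in A then x ord0 j else 0).

Definition supported A x : Prop := forall j, j \notin A -> x ord0 j = 0.

(* coordinates of [x] on [A], of [z] outside [A] *)
Definition merge_coords A x z : 'rV[R]_d :=
  \row_(j < d) (if j \in A then x ord0 j else z ord0 j).

End Euclidean.

Section Probability.
Context {R : realType} {dT : measure_display} {T : measurableType dT}.
Variable P : probability T R.

(* Mutual independence of a family of collections of events: the product rule
   holds for every choice of finitely many distinct indices. *)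
Definition mutually_independent (I : Type) (E : I -> set (set T)) : Prop :=
  forall (m : nat) (s : 'I_m -> I) (B : 'I_m -> set T),
    injective s -> (forall a, E (s a) (B a)) ->
    P (\bigcap_(a in [set: 'I_m]) B a) = (\prod_(a < m) P (B a))%E.

Context {n d : nat}.

(* [C s x] is the random value C_A(x); the class U(omega) is the case where
   [A] is the set of all coordinates. *)
Definition compressor_on (A : {set 'I_d}) (omega : R)
    (C : T -> 'rV[R]_d -> 'rV[R]_d) : Prop :=
  forall x, supported A x ->
    [/\ forall s, supported A (C s x),
        forall j, ('E_P[fun s => C s x ord0 j] = (x ord0 j)%:E)%E
      & ('E_P[fun s => sqnorm (C s x - x)] <= (omega * sqnorm x)%:E)%E].

Definition average_variance_on (A : {set 'I_d}) (omega_av : R)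
    (C : 'I_n -> T -> 'rV[R]_d -> 'rV[R]_d) : Prop :=
  forall x : 'I_n -> 'rV[R]_d, (forall i, supported A (x i)) ->
    ('E_P[fun s => sqnorm (n%:R^-1 *: \sum_(i < n) (C i s (x i) - x i))]
      <= (omega_av / n%:R * \sum_(i < n) sqnorm (x i))%:E)%E.

End Probability.

(* Random maps are given by jointly measurable functions of a random seed and
   of their argument.  At each round the workers' compressors share one seed,
   so that they may be arbitrarily dependent; the server has its own seed.
   A subset is attached to every round, but it is only used in communication
   rounds. *)
Record randomness (R : realType) (n d : nat) (T XW XS : Type) := Randomness {
  coin : nat -> T -> bool;
  round_subset : nat -> T -> {set 'I_d};
  wseed : nat -> T -> XW;
  sseed : nat -> T -> XS;
  wmap : nat -> 'I_n -> {set 'I_d} -> XW -> 'rV[R]_d -> 'rV[R]_d;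
  smap : nat -> {set 'I_d} -> XS -> 'rV[R]_d -> 'rV[R]_d
}.

Definition wcomp (R : realType) (n d : nat) (T XW XS : Type)
    (r : randomness R n d T XW XS) (t : nat) (i : 'I_n) (A : {set 'I_d})
    (s : T) : 'rV[R]_d -> 'rV[R]_d :=
  wmap r t i A (wseed r t s).

Definition scomp (R : realType) (n d : nat) (T XW XS : Type)
    (r : randomness R n d T XW XS) (t : nat) (A : {set 'I_d})
    (s : T) : 'rV[R]_d -> 'rV[R]_d :=
  smap r t A (sseed r t s).

Inductive source :=
  | CoinAt of nat | SubsetAt of nat | WorkersAt of nat | ServerAt of nat.

Section RandomnessAssumptions.
Context {R : realType} {n d : nat}.
Context {dT dW dS : measure_display} {T : measurableType dT}
  {XW : measurableType dW} {XS : measurableType dS}.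
Variable P : probability T R.
Variable r : randomness R n d T XW XS.

Definition source_events (a : source) : set (set T) :=
  match a with
  | CoinAt t => preimage_set_system setT (coin r t) setT
  | SubsetAt t => preimage_set_system setT (round_subset r t) setT
  | WorkersAt t => preimage_set_system setT (wseed r t) measurable
  | ServerAt t => preimage_set_system setT (sseed r t) measurable
  end.

(* R^d carries its Borel sigma-algebra, in the form of the product
   sigma-algebra of d.-tuple R. *)
Definition jointly_measurable (dX : measure_display) (X : measurableType dX)
    (C : X -> 'rV[R]_d -> 'rV[R]_d) : Prop :=
  forall j, measurable_fun [set: X * d.-tuple R]
    (fun z => C z.1 (\row_(l < d) tnth z.2 l) ord0 j).

Definition measurable_randomness : Prop :=
  [/\ forall t, measurable_fun [set: T] (coin r t),
      forall t A, measurable (round_subset r t @^-1` [set A]),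
      forall t, measurable_fun [set: T] (wseed r t),
      forall t, measurable_fun [set: T] (sseed r t)
    & forall t A, (forall i, jointly_measurable (wmap r t i A)) /\
                  jointly_measurable (smap r t A)].

(* The coin of round [t] has parameter [p t.+1]; the subsets are uniform
   among those of cardinality [k]. *)
Definition sampling_assumption (p : nat -> R) (k : nat) : Prop :=
  (forall t, P (coin r t @^-1` [set true]) = (p t.+1)%:E) /\
  (forall t A, P (round_subset r t @^-1` [set A]) =
    (if #|A| == k then 'C(d, k)%:R^-1 else 0)%:E).

(* Mutual independence of the seeds amounts to independence of the pairs
   (workers, server) over the rounds together with independence of the two
   components of each pair. *)
Definition independence_assumption : Prop :=
  mutually_independent P source_events.

Definition compressor_assumption (omega omega_s omega_av : R) : Prop :=
  forall t A,
  [/\ forall i, compressor_on P A omega (wcomp r t i A),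
      compressor_on P A omega_s (scomp r t A)
    & average_variance_on P A omega_av (fun i => wcomp r t i A)].

End RandomnessAssumptions.

(* [xw], [uw]: workers; [xs], [us]: the index s; [yy], [uy]: the model y and
   its control variate. *)
Record state (R : realType) (n d : nat) := State {
  xw : 'I_n -> 'rV[R]_d;
  xs : 'rV[R]_d;
  yy : 'rV[R]_d;
  uw : 'I_n -> 'rV[R]_d;
  us : 'rV[R]_d;
  uy : 'rV[R]_d
}.

Section BiCoLoR.
Context {R : realType} {n d : nat}.
Variables (f : 'I_n -> 'rV[R]_d -> R) (fs g : 'rV[R]_d -> R).
Variables (gamma eta eta_y rho rho_y : R) (p : nat -> R) (k : nat).

Definition bicolor_step (pt : R) (theta : bool) (A : {set 'I_d})
    (Cw : 'I_n -> 'rV[R]_d -> 'rV[R]_d) (Cs : 'rV[R]_d -> 'rV[R]_d)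
    (z : state R n d) : state R n d :=
  let hw i := xw z i - gamma *: gradient (f i) (xw z i) + gamma *: uw z i in
  let hs := xs z - gamma *: gradient fs (xs z) + gamma *: us z in
  let hy := yy z - gamma *: gradient g (yy z) + gamma *: uy z in
  if theta then
    let c i := Cw i (restrict_coords A (hw i) - restrict_coords A hy) in
    let cs := Cs (restrict_coords A hs - restrict_coords A hy) in
    let cbar := n%:R^-1 *: \sum_(i < n) c i in
    let a := pt * k%:R / (d%:R * gamma) in
    let b := pt * k%:R / (2 * d%:R * gamma) in
    {| xw := fun i =>
         merge_coords A ((1 - rho) *: hw i + rho *: (cs + hy)) (hw i);
       xs := merge_coords A ((1 - (rho + rho_y) / 2) *: hs
                      + ((rho + rho_y) / 2) *: hy + (rho / 2) *: cbar) hs;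
       yy := hy + rho_y *: cs;
       uw := fun i => uw z i - (a * eta) *: (c i - cs);
       us := us z + (b * eta) *: cbar - (b * (eta_y + eta)) *: cs;
       uy := uy z + (a * eta_y) *: cs |}
  else
    {| xw := hw; xs := hs; yy := hy; uw := uw z; us := us z; uy := uy z |}.

Context {T XW XS : Type}.
Variable r : randomness R n d T XW XS.

Fixpoint bicolor (z0 : state R n d) (t : nat) (s : T) : state R n d :=
  if t is t'.+1 then
    let A := round_subset r t' s in
    bicolor_step (p t'.+1) (coin r t' s) A
      (fun i => wcomp r t' i A s) (scomp r t' A s) (bicolor z0 t' s)
  else z0.

End BiCoLoR.

Section Lyapunov.
Context {R : realType} {n d : nat}.
Variables (f : 'I_n -> 'rV[R]_d -> R) (fs g : 'rV[R]_d -> R).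

Definition objective (x : 'rV[R]_d) : R :=
  n%:R^-1 * (\sum_(i < n) f i x) + 2 * fs x + g x.

Definition lyapunov (gamma eta p : R) (k : nat) (xstar : 'rV[R]_d)
    (z : state R n d) : R :=
  gamma^-1 * ((\sum_(i < n) sqnorm (xw z i - xstar))
              + 2 * n%:R * sqnorm (xs z - xstar)
              + n%:R * sqnorm (yy z - xstar))
  + d%:R ^+ 2 * gamma / (p ^+ 2 * k%:R ^+ 2 * eta)
    * ((\sum_(i < n) sqnorm (uw z i - gradient (f i) xstar))
       + n%:R * sqnorm (uy z - gradient g xstar)).

Definition rate (gamma mu L eta p : R) (k : nat) : R :=
  Num.max (Num.max ((1 - gamma * mu) ^+ 2) ((1 - gamma * L) ^+ 2))
          (1 - p ^+ 2 * k%:R ^+ 2 * eta / d%:R ^+ 2).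

End Lyapunov.

(* Main.v *)
(* With [v = u - u*] and [e] the error after a gradient step, the
   invariant [(1/n) sum_i u_i + 2 u_s + u_y = 0] makes the cross terms produced
   by a communication round collapse, after averaging over the coin and the
   subset, to [-2 <v, e>] summed over all nodes; completing the square turns the
   contraction of the gradient step into the decrease of the distance and of
   [|v|^2] simultaneously.  For the prescribed [rho] and [eta] the remaining
   quadratic terms of the round are nonpositive, coordinate by coordinate.
   The sources of randomness of a round are integrated out in the order
   workers, server, subset, coin: each is independent of the sigma-algebra
   generated by those before it, so that Fubini's theorem applies.
   The geometric decay of [E Psi^t] makes the sum of the [Psi^t] integrable,
   hence [Psi^t] tends to [0] almost surely. *)
From HB Require Import structures.
Require Import Defs.
From mathcomp Require Import all_boot all_order all_algebra.
From mathcomp Require Import all_classical all_reals all_analysis.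
From mathcomp Require Import measurable_realfun.
From mathcomp Require Import ring lra zify.

Set Implicit Arguments.
Unset Strict Implicit.
Unset Printing Implicit Defensive.

Import Order.TTheory GRing.Theory Num.Theory.
Import numFieldNormedType.Exports.

Local Open Scope classical_set_scope.
Local Open Scope ring_scope.

(** * Smooth strongly convex functions *)

(** The constants have the following origin. Let [W] be the weight of the control variates in
    [lyapunov] and [kappa] the factor of the messages in their updates. The number [tau = p k / d]
    is the probability that a given coordinate is exchanged, and [W * kappa = tau^-1]: this is why
    the cross terms survive averaging with the exact factor 2. The identity
    [W - gamma = (1 - p^2 k^2 eta / d^2) W] produces the last entry of the rate. The prescribed
    [rho] and [eta] are those that annihilate the two brackets without evident sign in a
    sum-of-squares identity for one coordinate of one worker. The probabilistic obstacle is that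
    compressors are controlled at deterministic arguments only, while the algorithm applies them to
    iterates that depend on the past. Each source is therefore decoupled from the sigma-algebra of
    all sources listed before it, so that the iterate can be frozen in the inner integral. All
    intermediate bounds are nonnegative functions, so Tonelli suffices and integrability of [Psi]
    does not have to be carried along. *)

Section EuclideanSpace.
Context {R : realType} {d : nat}.
Implicit Types (x z v : 'rV[R]_d) (f : 'rV[R]_d -> R).

Definition dotp x z : R := \sum_(j < d) x ord0 j * z ord0 j.

Lemma sqnorm_ge0 x : 0 <= sqnorm x.
Proof. by apply: sumr_ge0 => j _; exact: sqr_ge0. Qed.

Lemma sqr_enorm x : enorm x ^+ 2 = sqnorm x.
Proof. by rewrite /enorm sqr_sqrtr// sqnorm_ge0. Qed.

Lemma enorm_ge0 x : 0 <= enorm x.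
Proof. exact: sqrtr_ge0. Qed.

Lemma dotpp x : dotp x x = sqnorm x.
Proof. by apply: eq_bigr => j _; rewrite expr2. Qed.

Lemma dotpC x z : dotp x z = dotp z x.
Proof. by apply: eq_bigr => j _; rewrite mulrC. Qed.

Lemma dotpDl x y z : dotp (x + y) z = dotp x z + dotp y z.
Proof. by rewrite -big_split/=; apply: eq_bigr => j _; rewrite !mxE mulrDl. Qed.

Lemma dotpZl a x z : dotp (a *: x) z = a * dotp x z.
Proof. by rewrite mulr_sumr; apply: eq_bigr => j _; rewrite !mxE mulrA. Qed.

Lemma dotpNl x z : dotp (- x) z = - dotp x z.
Proof. by rewrite -scaleN1r dotpZl mulN1r. Qed.

Lemma dotpDr x y z : dotp x (y + z) = dotp x y + dotp x z.
Proof. by rewrite ![dotp x _]dotpC dotpDl. Qed.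

Lemma dotpZr a x z : dotp x (a *: z) = a * dotp x z.
Proof. by rewrite ![dotp x _]dotpC dotpZl. Qed.

Lemma dotpNr x z : dotp x (- z) = - dotp x z.
Proof. by rewrite ![dotp x _]dotpC dotpNl. Qed.

Definition dotpE := (dotpDl, dotpDr, dotpZl, dotpZr, dotpNl, dotpNr).

Lemma sqnormZ a x : sqnorm (a *: x) = a ^+ 2 * sqnorm x.
Proof. by rewrite -!dotpp !dotpE mulrA expr2. Qed.

Lemma sqnormN x : sqnorm (- x) = sqnorm x.
Proof. by rewrite -!dotpp !dotpE opprK. Qed.

Lemma sqnorm_eq0 x : sqnorm x = 0 -> x = 0.
Proof.
move=> x0; apply/rowP => j; rewrite mxE; apply/eqP; rewrite -sqrf_eq0.
have /eqP := x0; rewrite psumr_eq0 => [/allP/(_ j)|i _]; last exact: sqr_ge0.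
by rewrite mem_index_enum => /(_ isT).
Qed.

Lemma cauchy_schwarz x z : `|dotp x z| <= enorm x * enorm z.
Proof.
(* This vector has squared norm [c * (a * c - b ^+ 2)], with no division; only [c = 0] has to be
   treated apart. *)
have := sqnorm_ge0 (sqnorm z *: x - dotp x z *: z).
rewrite -!dotpp !dotpE [dotp z x]dotpC.
set a := dotp x x; set b := dotp x z; set c := dotp z z => H.
have b2 : b ^+ 2 <= a * c.
  have [c0|c0] := eqVneq c 0.
    have /sqnorm_eq0 z0 : sqnorm z = 0 by rewrite -dotpp.
    by rewrite /b /c z0 -(scale0r 0) !dotpE !mul0r mulr0 expr0n.
  have {c0}cp : 0 < c by rewrite lt0r c0 /c dotpp sqnorm_ge0.
  rewrite -subr_ge0 -(pmulr_rge0 _ cp); apply: le_trans H _.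
  by rewrite le_eqVlt; apply/orP; left; apply/eqP; ring.
rewrite -(@ler_pXn2r _ 2)// ?nnegrE ?mulr_ge0 ?enorm_ge0//.
by rewrite exprMn !sqr_enorm real_normK ?num_real// -!dotpp.
Qed.

Lemma derive_gradient f x v : differentiable f x ->
  'D_v f x = dotp (gradient f x) v.
Proof.
move=> df; rewrite deriveE// {1}(row_sum_delta v) linear_sum; apply: eq_bigr => j _.
by rewrite linearZ/= mxE deriveE// mulrC.
Qed.

Lemma is_derive_line f x v t : differentiable f (x + t *: v) ->
  is_derive t 1 (fun t => f (x + t *: v)) (dotp (gradient f (x + t *: v)) v).
Proof.
move=> df; rewrite -derive_gradient//.
have E : (fun h : R => h^-1 *: (f (x + (h *: (1 : R) + t) *: v) - f (x + t *: v)))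
   = (fun h : R => h^-1 *: (f (h *: v + (x + t *: v)) - f (x + t *: v))).
  apply/funext => h; congr (_ *: (f _ - _)).
  by rewrite [h *: 1]mulr1 scalerDl addrCA.
apply: DeriveDef; rewrite /derivable /derive E //.
exact: diff_derivable.
Qed.

(* Compare [phi] with the parabola of slope [D + K t] by monotonicity. *)
Lemma le_parabola (phi dphi : R -> R) (D K : R) :
  (forall t, is_derive t (1 : R) phi (dphi t)) ->
  (forall t, 0 < t -> t < 1 -> dphi t <= D + K * t) ->
  phi 1 <= phi 0 + D + K / 2.
Proof.
move=> dp le.
have dpsi (t : R) : is_derive t (1 : R)
    (phi - (fun s => s * D + K / 2 * s ^+ 2)) (dphi t - (D + K * t)).
  apply: is_deriveB.
  have -> : (fun s => s * D + K / 2 * s ^+ 2)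
     = ((D \*: (id : R -> R)) + ((K / 2) \*: ((id : R -> R) ^+ 2))).
    by apply/funext => s; rewrite !fctE/= /GRing.scale/= mulrC.
  apply: (is_derive_eq (is_deriveD (is_deriveZ D (is_derive_id t 1))
    (is_deriveZ (K / 2) (is_deriveX 2 (is_derive_id t 1))))).
  by rewrite /GRing.scale/=; field.
have cont : {within `[0, 1], continuous (phi - (fun s => s * D + K / 2 * s ^+ 2))}.
  by apply: derivable_within_continuous => t _; apply: ex_derive.
have [c] := MVT ltr01 (fun t _ => dpsi t) cont; rewrite in_itv/= => /andP[c0 c1].
rewrite !fctE/= subr0 mulr1 => E.
have := le c c0 c1; lra.
Qed.

Section Smooth.
Variables (L : R) (f : 'rV[R]_d -> R).
Hypothesis Lf : smooth L f.

Lemma smooth_line x v t : 0 <= t ->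
  `|dotp (gradient f (x + t *: v)) v - dotp (gradient f x) v|
    <= L * sqnorm v * t.
Proof.
move=> t0; rewrite -dotpNl -dotpDl.
apply: le_trans (cauchy_schwarz _ _) _.
have := Lf.2 (x + t *: v) x.
have -> : x + t *: v - x = t *: v by rewrite addrC addKr.
have -> : enorm (t *: v) = t * enorm v.
  by rewrite /enorm sqnormZ sqrtrM ?sqr_ge0// sqrtr_sqr ger0_norm.
move=> H; apply: le_trans (ler_wpM2r (enorm_ge0 v) H) _.
by rewrite -sqr_enorm; rewrite le_eqVlt; apply/orP; left; apply/eqP; ring.
Qed.

Lemma smooth_upper x v :
  f (x + v) <= f x + dotp (gradient f x) v + L / 2 * sqnorm v.
Proof.
have := @le_parabola (fun t => f (x + t *: v))
  (fun t => dotp (gradient f (x + t *: v)) v) (dotp (gradient f x) v)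
  (L * sqnorm v) (fun t => is_derive_line (Lf.1 _)).
rewrite scale1r scale0r addr0 [L / 2 * _]mulrAC; apply => t t0 _.
by have := smooth_line x v (ltW t0); rewrite ler_norml => /andP[]; lra.
Qed.

Lemma smooth_lower x v :
  f x + dotp (gradient f x) v - L / 2 * sqnorm v <= f (x + v).
Proof.
have H (t : R) : is_derive t (1 : R) (- (fun t => f (x + t *: v)))
    (- dotp (gradient f (x + t *: v)) v).
  by apply: is_deriveN; apply: is_derive_line (Lf.1 _).
have := @le_parabola _ _ (- dotp (gradient f x) v) (L * sqnorm v) H.
rewrite !fctE scale1r scale0r addr0 [L / 2 * _]mulrAC => H1.
suff: - f (x + v) <= - f x - dotp (gradient f x) v + L * sqnorm v / 2 by lra.
apply: H1 => t t0 _.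
by have := smooth_line x v (ltW t0); rewrite ler_norml => /andP[]; lra.
Qed.

Lemma le_of_forall_small (a b K : R) :
  (forall t, 0 < t -> t <= 1 -> a <= b + K * t) -> a <= b.
Proof.
move=> H; rewrite leNgt; apply/negP => ba.
have K0 : 0 < `|K| + (a - b) + 1 by have := normr_ge0 K; lra.
(* The product of this value with its denominator is [a - b], which forces [K * t < a - b] and
   contradicts the hypothesis at [t]. *)
have t0 : 0 < (a - b) / (`|K| + (a - b) + 1) by apply: divr_gt0 => //; lra.
have t1 : (a - b) / (`|K| + (a - b) + 1) <= 1.
  by rewrite ler_pdivrMr// mul1r; have := normr_ge0 K; lra.
have := H _ t0 t1; set t := _ / _ => Ht.
have tE : t * (`|K| + (a - b) + 1) = a - b by rewrite /t divfK// gt_eqF.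
have := ler_wpM2r (ltW t0) (ler_norm K); rewrite -/t.
have ab : 0 < a - b by lra.
have := mulr_gt0 t0 ab; rewrite -/t; nra.
Qed.

(** Convexity bounds [f (x + t v)] above by a chord, [smooth_lower] bounds it below by the tangent
    up to order [t ^+ 2]. After division by [t] the error is [(L + mu) / 2 * sqnorm v * t], which
    vanishes as [t] tends to 0. *)
Lemma convex_lower mu x v : strongly_convex mu f ->
  f x + dotp (gradient f x) v + mu / 2 * sqnorm v <= f (x + v).
Proof.
move=> cf; apply: (@le_of_forall_small _ _ ((L + mu) / 2 * sqnorm v)) => t t0 t1.
have t01 : 0 <= t <= 1 by rewrite (ltW t0).
have := cf (Itv01 (ltW t0) t1) (x + v) x (mem_set I) (mem_set I).
rewrite !convRE /conv/= /unstable.onem.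
have -> : t *: (x + v) + (1 - t) *: x = x + t *: v.
  by apply/rowP => j; rewrite !mxE; ring.
have := smooth_lower x (t *: v).
rewrite -!dotpp !dotpE [dotp v x]dotpC.
set a := f (x + t *: v); set G := dotp _ v; set V := dotp v v.
set b := f (x + v); set c := f x; set e := dotp x v; set X := dotp x x.
move=> A B.
suff: t * (c + G + mu / 2 * V) <= t * (b + (L + mu) / 2 * V * t).
  by rewrite ler_pM2l.
lra.
Qed.

(* Cocoercivity of the gradient of [f - mu/2 |.|^2], which is convex and
   [M]-smooth for every [M >= L - mu]: minimize the quadratic upper bound at
   [z] against the linear lower bound at [x]. *)
Lemma cocoercive_half mu M x z : strongly_convex mu f -> L - mu <= M -> 0 < M ->
  forall D, D = gradient f z - gradient f x - mu *: (z - x) ->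
  f x + dotp (gradient f x) (z - x) + mu / 2 * sqnorm (z - x)
    + (2 * M)^-1 * sqnorm D <= f z.
Proof.
move=> cf LM M0 D DE.
have := convex_lower x (z - M^-1 *: D - x) cf.
rewrite [x + (_ - x)]addrC subrK.
have := smooth_upper z (- (M^-1 *: D)).
have -> : z - M^-1 *: D - x = (z - x) - M^-1 *: D by rewrite addrAC.
have -> : gradient f z = gradient f x + mu *: (z - x) + D.
  by rewrite DE; apply/rowP => j; rewrite !mxE; ring.
rewrite -!dotpp !dotpE.
rewrite [dotp z D]dotpC [dotp x D]dotpC [dotp (gradient f x) D]dotpC [dotp z x]dotpC.
set a := dotp D D; set b := dotp D z; set c := dotp D x.
set e := dotp D (gradient f x).
move: (f _) (f _) => F F'.
have a0 : 0 <= a by rewrite /a dotpp sqnorm_ge0.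
have := ler_wpM2r (mulr_ge0 (sqr_ge0 M^-1) a0) LM.
have -> : M * (M^-1 ^+ 2 * a) = M^-1 * a by field; lra.
have -> : (2 * M)^-1 = M^-1 / 2 by field; lra.
lra.
Qed.

(** The two half inequalities, with [x] and [z] exchanged, add up to the claim with a positive [M]
    in place of [L - mu]. Since [L - mu] may be 0, take [M = L - mu + t] and let [t] tend to 0. *)
Lemma cocoercive mu x z : strongly_convex mu f -> mu <= L ->
  forall D, D = gradient f z - gradient f x - mu *: (z - x) ->
  sqnorm D <= (L - mu) * dotp D (z - x).
Proof.
move=> cf muL D DE.
apply: (@le_of_forall_small _ _ (dotp D (z - x))) => t t0 _.
have M0 : 0 < L - mu + t by lra.
have le : L - mu <= L - mu + t by lra.
have := cocoercive_half cf le M0 DE.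
have := cocoercive_half (x := z) (z := x) cf le M0 erefl.
have -> : gradient f x - gradient f z - mu *: (x - z) = - D.
  by rewrite DE; apply/rowP => j; rewrite !mxE; ring.
have -> : x - z = - (z - x) by rewrite opprB.
rewrite !sqnormN /= => A B.
suff H : (L - mu + t)^-1 * sqnorm D <= dotp D (z - x).
  by move: H; rewrite ler_pdivrMl// mulrDl [t * _]mulrC.
have GE : dotp D (z - x) = dotp (gradient f z) (z - x)
    - dotp (gradient f x) (z - x) - mu * sqnorm (z - x).
  by rewrite {1}DE -dotpp !dotpE; ring.
rewrite GE; move: A B; rewrite dotpNr.
have -> : (2 * (L - mu + t))^-1 = (L - mu + t)^-1 / 2 by field; lra.
by set i := (_ + t)^-1; lra.
Qed.

(** Cocoercivity reads [a <= (mu + L) * b - mu * L * c], so the squared norm of [v - gamma g] is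
    bounded by an affine function of [b], where [mu * c <= b <= L * c]. Its values at the two ends
    are [(1 - gamma mu)^2 c] and [(1 - gamma L)^2 c]; the sign of [gamma * (mu + L) - 2] tells which
    end is the larger. *)
Lemma gradient_step_contraction mu gamma x z :
  strongly_convex mu f -> mu <= L -> 0 < gamma ->
  sqnorm ((x - gamma *: gradient f x) - (z - gamma *: gradient f z))
    <= Num.max ((1 - gamma * mu) ^+ 2) ((1 - gamma * L) ^+ 2) * sqnorm (x - z).
Proof.
move=> cf muL g0.
have := cocoercive (x := z) (z := x) cf muL erefl.
have -> : x - gamma *: gradient f x - (z - gamma *: gradient f z)
  = (x - z) - gamma *: (gradient f x - gradient f z).
  by apply/rowP => j; rewrite !mxE; ring.
move: (x - z) (gradient f x - gradient f z) => v g.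
rewrite -!dotpp !dotpE [dotp v g]dotpC.
set a := dotp g g; set b := dotp g v; set c := dotp v v => H.
have c0 : 0 <= c by rewrite /c dotpp sqnorm_ge0.
have sq : 0 <= dotp (g - mu *: v) (g - mu *: v) by rewrite dotpp sqnorm_ge0.
move: sq; rewrite !dotpE [dotp v g]dotpC -/a -/b -/c => sq.
(* For [mu = L] cocoercivity forces [g = mu *: v]. It is settled first because the bounds on [b] are
   obtained by cancelling [L - mu]. *)
have [muL'|] := ltrP mu L; last first.
  move=> Lmu; have E : L = mu by lra.
  rewrite E maxxx; move: H; rewrite E subrr mul0r => H.
  have nn : dotp (g - mu *: v) (g - mu *: v) <= 0.
    by rewrite !dotpE [dotp v g]dotpC -/a -/b -/c.
  have /sqnorm_eq0 gE : sqnorm (g - mu *: v) = 0.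
    by apply/eqP; rewrite eq_le sqnorm_ge0 -dotpp nn.
  have {}gE : g = mu *: v by apply/eqP; rewrite -subr_eq0 gE.
  by rewrite /a /b gE !dotpE -/c; lra.
have bl : mu * c <= b.
  suff: 0 <= (L - mu) * (b - mu * c) by rewrite pmulr_rge0; lra.
  lra.
have bu : b <= L * c.
  have sq' : 0 <= dotp (g - L *: v) (g - L *: v) by rewrite dotpp sqnorm_ge0.
  move: sq'; rewrite !dotpE [dotp v g]dotpC -/a -/b -/c => sq'.
  suff: 0 <= (L - mu) * (L * c - b) by rewrite pmulr_rge0; lra.
  lra.
have aE : a <= (mu + L) * b - mu * L * c.
  by move: H; lra.
have ga := ler_wpM2l (sqr_ge0 gamma) aE.
have [le|ge] := lerP (gamma * (mu + L)) 2.
  apply: (@le_trans _ _ ((1 - gamma * mu) ^+ 2 * c)); last first.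
    by rewrite ler_wpM2r// le_max lexx.
  have u0 : 0 <= gamma * (2 - gamma * (mu + L)) by rewrite mulr_ge0//; lra.
  have := ler_wpM2l u0 bl; lra.
apply: (@le_trans _ _ ((1 - gamma * L) ^+ 2 * c)); last first.
  by rewrite ler_wpM2r// le_max lexx orbT.
have u0 : 0 <= gamma * (gamma * (mu + L) - 2) by rewrite mulr_ge0//; lra.
have := ler_wpM2l u0 bu; lra.
Qed.

Lemma coord_le_enorm x j : `|x ord0 j| <= enorm x.
Proof.
rewrite -(@ler_pXn2r _ 2)// ?nnegrE ?enorm_ge0//.
rewrite sqr_enorm real_normK ?num_real// /sqnorm (bigD1 j)//= lerDl.
by apply: sumr_ge0 => i _; exact: sqr_ge0.
Qed.

Lemma sqnorm_le_norm x : sqnorm x <= d%:R * `|x| ^+ 2.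
Proof.
rewrite -[X in X%:R * _](card_ord d) mulr_natl -sumr_const; apply: ler_sum => j _.
rewrite -[leLHS]real_normK ?num_real// ler_pXn2r ?nnegrE//.
rewrite [leRHS]/Num.norm /= mx_normrE.
by apply: (@le_bigmax _ _ _ _ (fun ij : 'I_1 * 'I_d => `|x ij.1 ij.2|) (ord0, j)).
Qed.

(** Serves to make the iterates measurable functions of the sources. *)
Lemma gradient_continuous j : continuous (fun x => gradient f x ord0 j).
Proof.
move=> x; apply/(@pseudometric_normed_Zmodule.cvgrPdist_le R R _ _ (nbhs_filter x)) => e e0.
(* The factor [d + 1] crudely bounds the Euclidean norm by the sup norm; the last [1] keeps [K]
   positive when [L = 0]. *)
pose K := `|L| * (d%:R + 1) + 1.
have K0 : 0 < K by rewrite ltr_wpDl// mulr_ge0// addr_ge0.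
near=> z.
have -> : gradient f x ord0 j - gradient f z ord0 j
   = (gradient f x - gradient f z) ord0 j by rewrite !mxE.
apply: le_trans (coord_le_enorm _ _) _.
apply: le_trans (Lf.2 _ _) _.
have n0 : 0 <= `|x - z| by [].
have h : enorm (x - z) <= (d%:R + 1) * `|x - z|.
  rewrite -(@ler_pXn2r _ 2)// ?nnegrE ?enorm_ge0// ?mulr_ge0 ?addr_ge0//.
  rewrite sqr_enorm; apply: le_trans (sqnorm_le_norm _) _.
  rewrite exprMn ler_wpM2r ?sqr_ge0//.
  have : 0 <= (d%:R : R) by []. nra.
apply: le_trans (ler_wpM2r (enorm_ge0 _) (ler_norm L)) _.
apply: le_trans (ler_wpM2l (normr_ge0 L) h) _.
rewrite mulrA; apply: (@le_trans _ _ (K * `|x - z|)).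
  by rewrite ler_wpM2r// /K lerDl.
rewrite -ler_pdivlMl//.
near: z; apply/nbhs_ballP; exists (K^-1 * e); first by rewrite /= mulr_gt0// invr_gt0.
by move=> z; rewrite -ball_normE/= => /ltW.
Unshelve. all: by end_near. Qed.
End Smooth.

End EuclideanSpace.

(** * One communication round *)

Section CommunicationRound.
Variable (R : realType).
Implicit Types (rho eta omega omega_s omega_av : R).

(** The difference of the two sides is a sum of squares. The parallelogram law trades [(e - y) ^+ 2]
    for [(e - s) ^+ 2 + (y - s) ^+ 2], and the coefficient of the latter splits into the two
    brackets [1 - rho * (2 + omega_av + 2 * omega_s)] and [rho - eta * (1 + 2 * omega + 2 *
    omega_s)]; the choice of [rho] and [eta] makes both vanish. *)
Lemma round_coord1 rho eta omega omega_s omega_av (e s y : R) :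
  0 <= omega -> 0 <= omega_s -> 0 <= omega_av -> 0 <= eta ->
  rho * (2 + omega_av + 2 * omega_s) = 1 ->
  eta * (1 + 2 * omega + 2 * omega_s) = rho ->
  ((1 - rho) * e + rho * s) ^+ 2
    + 2 * ((1 - rho) * s + rho * ((y + e) / 2)) ^+ 2
    + ((1 - rho) * y + rho * s) ^+ 2
    + (rho ^+ 2 * omega_av / 2) * (e - y) ^+ 2
    + 2 * rho ^+ 2 * omega_s * (s - y) ^+ 2
    + eta * ((e - s) ^+ 2 + omega * (e - y) ^+ 2 + (s - y) ^+ 2
             + 2 * omega_s * (s - y) ^+ 2)
  <= e ^+ 2 + 2 * s ^+ 2 + y ^+ 2.
Proof.
move=> o0 os0 oa0 eta0 H1 H2; rewrite -subr_ge0.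
set D := (X in 0 <= X).
have -> : D = 2 * omega_s * (rho ^+ 2 + eta) * (e - s) ^+ 2
   + rho ^+ 2 / 2 * (e - y) ^+ 2
   + (rho ^+ 2 * omega_av / 2 + eta * omega) * ((e - s) + (y - s)) ^+ 2
   + (rho * (1 - rho * (2 + omega_av + 2 * omega_s))
      + (rho - eta * (1 + 2 * omega + 2 * omega_s)))
     * ((e - s) ^+ 2 + (y - s) ^+ 2) by rewrite /D; field.
rewrite H1 H2 !subrr mulr0 addr0 mul0r addr0.
by do ?[apply: sqr_ge0 | apply: addr_ge0 | apply: mulr_ge0 | rewrite invr_ge0].
Qed.

(* The mean over the workers is handled by convexity of the square, which
   reduces the claim to a single worker. *)
Lemma round_coord n rho eta omega omega_s omega_av gamma W kappa tau
    (e v : 'I_n -> R) (s y vs vy : R) :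
  (0 < n)%N ->
  0 <= omega -> 0 <= omega_s -> 0 <= omega_av -> 0 <= eta -> 0 < gamma ->
  rho * (2 + omega_av + 2 * omega_s) = 1 ->
  eta * (1 + 2 * omega + 2 * omega_s) = rho ->
  W * kappa = tau^-1 -> W * kappa ^+ 2 = eta / gamma ->
  \sum_i v i + 2 * n%:R * vs + n%:R * vy = 0 ->
  gamma^-1 * (\sum_i ((1 - rho) * e i + rho * s) ^+ 2
    + 2 * n%:R * ((1 - rho) * s + rho / 2 * (y + n%:R^-1 * \sum_i e i)) ^+ 2
    + n%:R * ((1 - rho) * y + rho * s) ^+ 2)
  + W * (\sum_i (v i - kappa * (e i - s)) ^+ 2
         + n%:R * (vy + kappa * (s - y)) ^+ 2)
  + (gamma^-1 * (rho ^+ 2 * omega_av / 2) + W * kappa ^+ 2 * omega)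
    * (\sum_i (e i - y) ^+ 2)
  + 2 * n%:R * omega_s * (gamma^-1 * rho ^+ 2 + W * kappa ^+ 2) * (s - y) ^+ 2
  <= gamma^-1 * (\sum_i e i ^+ 2 + 2 * n%:R * s ^+ 2 + n%:R * y ^+ 2)
     + W * (\sum_i v i ^+ 2 + n%:R * vy ^+ 2)
     - 2 / tau * (\sum_i v i * e i + 2 * n%:R * (vs * s) + n%:R * (vy * y)).
Proof.
move=> n0 o0 os0 oa0 eta0 g0 H1 H2 Wk Wk2 V0.
have N0 : 0 < n%:R :> R by rewrite ltr0n.
have sumc (c : R) : \sum_(i < n) c = n%:R * c.
  by rewrite sumr_const card_ord mulr_natl.
have jensen : n%:R * ((1 - rho) * s + rho / 2 * (y + n%:R^-1 * \sum_i e i)) ^+ 2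
    <= \sum_i ((1 - rho) * s + rho * ((y + e i) / 2)) ^+ 2.
  set m := _ + _ * _.
  have : 0 <= \sum_i ((1 - rho) * s + rho * ((y + e i) / 2) - m) ^+ 2.
    by apply: sumr_ge0 => i _; exact: sqr_ge0.
  have -> : \sum_i ((1 - rho) * s + rho * ((y + e i) / 2) - m) ^+ 2 =
    \sum_i ((1 - rho) * s + rho * ((y + e i) / 2)) ^+ 2
    - 2 * m * (\sum_i ((1 - rho) * s + rho * ((y + e i) / 2))) + n%:R * m ^+ 2.
    rewrite -sumc mulr_sumr -sumrB -big_split/=; apply: eq_bigr => i _; ring.
  have -> : \sum_i ((1 - rho) * s + rho * ((y + e i) / 2)) = n%:R * m.
    rewrite big_split/= sumc -mulr_sumr -mulr_suml big_split/= sumc /m.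
    by field; lra.
  lra.
have sum1 : \sum_i (((1 - rho) * e i + rho * s) ^+ 2
    + 2 * ((1 - rho) * s + rho * ((y + e i) / 2)) ^+ 2
    + ((1 - rho) * y + rho * s) ^+ 2
    + (rho ^+ 2 * omega_av / 2) * (e i - y) ^+ 2
    + 2 * rho ^+ 2 * omega_s * (s - y) ^+ 2
    + eta * ((e i - s) ^+ 2 + omega * (e i - y) ^+ 2 + (s - y) ^+ 2
             + 2 * omega_s * (s - y) ^+ 2))
   <= \sum_i (e i ^+ 2 + 2 * s ^+ 2 + y ^+ 2).
  by apply: ler_sum => i _; exact: round_coord1.
move: sum1; rewrite !big_split/= !sumc -!mulr_sumr !big_split/= !sumc -!mulr_sumr.
have -> : \sum_i (v i - kappa * (e i - s)) ^+ 2 = \sum_i v i ^+ 2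
   - 2 * kappa * (\sum_i v i * e i - s * \sum_i v i)
   + kappa ^+ 2 * \sum_i (e i - s) ^+ 2.
  rewrite !mulr_sumr -sumrB mulr_sumr -sumrB -big_split/=.
  by apply: eq_bigr => i _; ring.
(* The balance replaces [s * \sum_i v i]; the resulting multiple of [vy * s] cancels the one from
   the square of [vy + kappa * (s - y)], which leaves one product per node. *)
have -> : \sum_i v i = - (2 * n%:R * vs + n%:R * vy) by lra.
have -> : 2 / tau = 2 * (W * kappa) by rewrite Wk.
have gE : eta = gamma * (W * kappa ^+ 2) by rewrite Wk2; field; lra.
move: jensen; rewrite {}gE.
set A1 := \sum_i ((1 - rho) * e i + rho * s) ^+ 2.
set A2 := \sum_i ((1 - rho) * s + _) ^+ 2; set A3 := (_ + _ * (y + _)) ^+ 2.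
set A4 := \sum_i (e i - y) ^+ 2; set A5 := \sum_i (e i - s) ^+ 2.
set A6 := \sum_i e i ^+ 2; set A7 := \sum_i v i ^+ 2; set A8 := \sum_i v i * e i.
move=> J S.
have gi0 : 0 < gamma^-1 by rewrite invr_gt0.
have gg : gamma^-1 * gamma = 1 by rewrite mulVf ?gt_eqF.
have J' := ler_wpM2l (ltW gi0) J.
have S' := ler_wpM2l (ltW gi0) S.
have GG (x : R) : gamma^-1 * (gamma * x) = x by rewrite mulrA gg mul1r.
move: S'; rewrite !mulrDr -![gamma * _ * _]mulrA !GG.
lra.
Qed.

End CommunicationRound.

Section RoundValue.
Context {R : realType} {n d : nat}.
Variables (gamma rho W kappa : R) (xstar : 'rV[R]_d).
Implicit Types (A : {set 'I_d}) (hw vw cw : 'I_n -> 'rV[R]_d)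
  (hs hy vs vy cs : 'rV[R]_d).

Definition gap A (x y : 'rV[R]_d) : 'rV[R]_d :=
  restrict_coords A x - restrict_coords A y.

Lemma gap_supported A x y : supported A (gap A x y).
Proof. by move=> j /negPf jA; rewrite !mxE jA subrr. Qed.

(* The Lyapunov value after a communication round, as a function of the
   messages [cw] and [cs]; [hw], [hs], [hy] are the iterates after the gradient
   step and [vw], [vy] the errors of the control variates. *)
Definition round_value A hw hs hy vw vy cw cs : R :=
  gamma^-1 *
    ((\sum_i sqnorm (merge_coords A ((1 - rho) *: hw i + rho *: hy) (hw i)
                     - xstar + rho *: cs))
     + 2 * n%:R * sqnorm (merge_coords A ((1 - rho) *: hs + rho *: hy) hs
                          - xstar + (rho / 2) *: (n%:R^-1 *: \sum_i cw i))
     + n%:R * sqnorm (hy - xstar + rho *: cs))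
  + W * ((\sum_i sqnorm (vw i - kappa *: (cw i - cs)))
         + n%:R * sqnorm (vy + kappa *: cs)).

Lemma sum_sqnorm (F : 'I_n -> 'rV[R]_d) :
  \sum_i sqnorm (F i) = \sum_j \sum_i F i ord0 j ^+ 2.
Proof. exact: exchange_big. Qed.

(** Both sides are sums over coordinates: [round_coord] handles those in [A], and outside [A] the
    messages vanish and the two sides coincide. The two terms added on the left are the noise that
    compression will add to the exact messages. *)
Lemma round_value_le omega omega_s omega_av eta tau A hw hs hy vw vs vy :
  (0 < n)%N ->
  0 <= omega -> 0 <= omega_s -> 0 <= omega_av -> 0 <= eta -> 0 < gamma ->
  rho * (2 + omega_av + 2 * omega_s) = 1 ->
  eta * (1 + 2 * omega + 2 * omega_s) = rho ->
  W * kappa = tau^-1 -> W * kappa ^+ 2 = eta / gamma ->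
  (forall j, \sum_i vw i ord0 j + 2 * n%:R * vs ord0 j + n%:R * vy ord0 j = 0) ->
  round_value A hw hs hy vw vy (fun i => gap A (hw i) hy) (gap A hs hy)
  + (gamma^-1 * (rho ^+ 2 * omega_av / 2) + W * kappa ^+ 2 * omega)
    * (\sum_i sqnorm (gap A (hw i) hy))
  + 2 * n%:R * omega_s * (gamma^-1 * rho ^+ 2 + W * kappa ^+ 2)
    * sqnorm (gap A hs hy)
  <= gamma^-1 * ((\sum_i sqnorm (hw i - xstar))
                 + 2 * n%:R * sqnorm (hs - xstar) + n%:R * sqnorm (hy - xstar))
     + W * ((\sum_i sqnorm (vw i)) + n%:R * sqnorm vy)
     - 2 / tau * \sum_(j in A)
       (\sum_i vw i ord0 j * (hw i - xstar) ord0 j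
        + 2 * n%:R * (vs ord0 j * (hs - xstar) ord0 j)
        + n%:R * (vy ord0 j * (hy - xstar) ord0 j)).
Proof.
move=> n0 o0 os0 oa0 eta0 g0 H1 H2 Wk Wk2 V0.
rewrite /round_value !sum_sqnorm [\sum_(j in A) _]big_mkcond /sqnorm.
rewrite !mulr_sumr -!big_split/= !mulr_sumr -!big_split/= -sumrB.
apply: ler_sum => j _.
have N0 : 0 < n%:R :> R by rewrite ltr0n.
have eqs (F G : 'I_n -> R) : F =1 G -> \sum_i F i = \sum_i G i by move=> /funext ->.
case: ifPn => jA.
  set e := fun i => (hw i - xstar) ord0 j.
  have := @round_coord R n rho eta omega omega_s omega_av gamma W kappa tau
    e (fun i => vw i ord0 j) ((hs - xstar) ord0 j) ((hy - xstar) ord0 j)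
    (vs ord0 j) (vy ord0 j) n0 o0 os0 oa0 eta0 g0 H1 H2 Wk Wk2 (V0 j).
  have -> : \sum_i ((1 - rho) * e i + rho * (hs - xstar) ord0 j) ^+ 2 =
     \sum_i (merge_coords A ((1 - rho) *: hw i + rho *: hy) (hw i)
                     - xstar + rho *: gap A hs hy) ord0 j ^+ 2.
    by apply: eqs => i; rewrite /e !mxE jA; congr (_ ^+ 2); ring.
  have -> : (1 - rho) * (hs - xstar) ord0 j
      + rho / 2 * ((hy - xstar) ord0 j + n%:R^-1 * \sum_i e i) =
      (merge_coords A ((1 - rho) *: hs + rho *: hy) hs
         - xstar + (rho / 2) *: (n%:R^-1 *: \sum_i gap A (hw i) hy)) ord0 j.
    rewrite !mxE jA summxE.
    have -> : \sum_i gap A (hw i) hy ord0 j = \sum_i e i - n%:R * (hy - xstar) ord0 j.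
      rewrite mulr_natl -[X in _ *+ X](card_ord n) -sumr_const -sumrB.
      by apply: eqs => i; rewrite /e !mxE jA; ring.
    by rewrite !mxE; field; lra.
  have -> : (1 - rho) * (hy - xstar) ord0 j + rho * (hs - xstar) ord0 j =
      (hy - xstar + rho *: gap A hs hy) ord0 j by rewrite !mxE jA; ring.
  have -> : \sum_i (vw i ord0 j - kappa * (e i - (hs - xstar) ord0 j)) ^+ 2
     = \sum_i (vw i - kappa *: (gap A (hw i) hy - gap A hs hy)) ord0 j ^+ 2.
    by apply: eqs => i; rewrite /e !mxE jA; congr (_ ^+ 2); ring.
  have -> : vy ord0 j + kappa * ((hs - xstar) ord0 j - (hy - xstar) ord0 j) =
     (vy + kappa *: gap A hs hy) ord0 j by rewrite !mxE jA; ring.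
  have -> : \sum_i (e i - (hy - xstar) ord0 j) ^+ 2 =
     \sum_i (gap A (hw i) hy) ord0 j ^+ 2.
    by apply: eqs => i; rewrite /e !mxE jA; congr (_ ^+ 2); ring.
  have -> : (hs - xstar) ord0 j - (hy - xstar) ord0 j = (gap A hs hy) ord0 j.
    by rewrite !mxE jA; ring.
  rewrite /e; lra.
have g0j x y : gap A x y ord0 j = 0 by rewrite gap_supported.
have addc (a b : 'rV[R]_d) : (a + b) ord0 j = a ord0 j + b ord0 j by rewrite mxE.
have scc c (a : 'rV[R]_d) : (c *: a) ord0 j = c * a ord0 j by rewrite mxE.
have oppc (a : 'rV[R]_d) : (- a) ord0 j = - a ord0 j by rewrite mxE.
rewrite mulr0 subr0 le_eqVlt; apply/orP; left; apply/eqP.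
have -> : \sum_i (merge_coords A ((1 - rho) *: hw i + rho *: hy) (hw i)
     - xstar + rho *: gap A hs hy) ord0 j ^+ 2 = \sum_i (hw i - xstar) ord0 j ^+ 2.
  apply: eqs => i; congr (_ ^+ 2).
  by rewrite addc scc g0j mulr0 addr0 !mxE (negPf jA).
have -> : (merge_coords A ((1 - rho) *: hs + rho *: hy) hs - xstar
    + (rho / 2) *: (n%:R^-1 *: \sum_i gap A (hw i) hy)) ord0 j
   = (hs - xstar) ord0 j.
  rewrite addc !scc summxE big1 => [|i _]; last exact: g0j.
  by rewrite !mulr0 addr0 !mxE (negPf jA).
have -> : (hy - xstar + rho *: gap A hs hy) ord0 j = (hy - xstar) ord0 j.
  by rewrite addc scc g0j mulr0 addr0.
have -> : \sum_i (vw i - kappa *: (gap A (hw i) hy - gap A hs hy)) ord0 j ^+ 2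
   = \sum_i vw i ord0 j ^+ 2.
  apply: eqs => i; congr (_ ^+ 2).
  by rewrite addc oppc scc addc oppc !g0j subrr mulr0 subr0.
have -> : (vy + kappa *: gap A hs hy) ord0 j = vy ord0 j.
  by rewrite addc scc g0j mulr0 addr0.
have -> : \sum_i (gap A (hw i) hy) ord0 j ^+ 2 = 0.
  by rewrite big1// => i _; rewrite g0j expr0n.
rewrite g0j; ring.
Qed.

End RoundValue.

Lemma balanced_coord (R : realType) (n d : nat) (u : 'I_n -> 'rV[R]_d)
    (s y : 'rV[R]_d) : (0 < n)%N ->
  n%:R^-1 *: (\sum_i u i) + 2 *: s + y = 0 ->
  forall j, \sum_i u i ord0 j + 2 * n%:R * s ord0 j + n%:R * y ord0 j = 0.
Proof.
move=> n0 /rowP E j; have := E j; rewrite !mxE summxE => {}E.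
have N0 : 0 < n%:R :> R by rewrite ltr0n.
transitivity (n%:R * (n%:R^-1 * (\sum_i u i ord0 j) + 2 * s ord0 j + y ord0 j)).
  by field; lra.
by rewrite E mulr0.
Qed.

(** * Decrease of the Lyapunov function in one step *)

Section Step.
Context {R : realType} {n d k : nat}.
Variables (f : 'I_n -> 'rV[R]_d -> R) (fs g : 'rV[R]_d -> R).
Variables (gamma eta rho p : R) (xstar : 'rV[R]_d).
Implicit Types (z : state R n d) (A : {set 'I_d}).

Definition hat (h : 'rV[R]_d -> R) (x u : 'rV[R]_d) : 'rV[R]_d :=
  x - gamma *: gradient h x + gamma *: u.

Definition hatw z i := hat (f i) (xw z i) (uw z i).
Definition hats z := hat fs (xs z) (us z).
Definition haty z := hat g (yy z) (uy z).

Let step := bicolor_step f fs g gamma eta eta rho rho k p.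
Let Psi := lyapunov f g gamma eta p k xstar.
Let W : R := d%:R ^+ 2 * gamma / (p ^+ 2 * k%:R ^+ 2 * eta).
Let kappa : R := p * k%:R / (d%:R * gamma) * eta.
Let tau : R := p * k%:R / d%:R.

Definition step_value A z cw cs :=
  round_value gamma rho W kappa xstar A (hatw z) (hats z) (haty z)
    (fun i => uw z i - gradient (f i) xstar) (uy z - gradient g xstar) cw cs.

(** Since the messages vanish outside [A], they may be taken out of [merge_coords]. This writes each
    new error as a constant plus a multiple of a message, the form in which means are computed. *)
Lemma lyapunov_step A z Cw Cs :
  let cw i := Cw i (gap A (hatw z i) (haty z)) in
  let cs := Cs (gap A (hats z) (haty z)) in
  (forall i, supported A (cw i)) -> supported A cs ->
  Psi (step true A Cw Cs z) = step_value A z cw cs.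
Proof.
move=> cw cs sw ss.
have Ew i : xw (step true A Cw Cs z) i - xstar
   = merge_coords A ((1 - rho) *: hatw z i + rho *: haty z) (hatw z i)
     - xstar + rho *: cs.
  rewrite -[xw _ _]/(merge_coords A
    ((1 - rho) *: hatw z i + rho *: (cs + haty z)) (hatw z i)).
  move: (hatw z i) (haty z) => h y.
  apply/rowP => j; rewrite !mxE; case: ifPn => jA; first by ring.
  by rewrite ss//; ring.
have Es : xs (step true A Cw Cs z) - xstar
   = merge_coords A ((1 - rho) *: hats z + rho *: haty z) (hats z)
     - xstar + (rho / 2) *: (n%:R^-1 *: \sum_i cw i).
  rewrite -[xs _]/(merge_coords A ((1 - (rho + rho) / 2) *: hats z
    + ((rho + rho) / 2) *: haty z + (rho / 2) *: (n%:R^-1 *: \sum_i cw i))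
    (hats z)).
  move: (hats z) (haty z) => h y.
  apply/rowP => j; rewrite !mxE; case: ifPn => jA.
    by move: (n%:R^-1 * _) => q; field.
  rewrite summxE big1 ?mulr0 ?addr0// => i _; exact: sw.
have Ey : yy (step true A Cw Cs z) - xstar = haty z - xstar + rho *: cs.
  by rewrite -[yy _]/(haty z + rho *: cs) addrAC.
have Eu i : uw (step true A Cw Cs z) i - gradient (f i) xstar
    = uw z i - gradient (f i) xstar - kappa *: (cw i - cs).
  by rewrite -[uw _ _]/(uw z i - kappa *: (cw i - cs)) addrAC.
have Euy : uy (step true A Cw Cs z) - gradient g xstar
    = uy z - gradient g xstar + kappa *: cs.
  by rewrite -[uy _]/(uy z + kappa *: cs) addrAC.
rewrite /Psi /lyapunov /step_value /round_value Es Ey Euy -/W.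
under eq_bigr do rewrite Ew.
by under [X in W * (X + _)]eq_bigr do rewrite Eu.
Qed.

Definition dual_balanced z : Prop :=
  n%:R^-1 *: (\sum_(i < n) uw z i) + 2 *: us z + uy z = 0.

Hypothesis n_gt0 : (0 < n)%N.

Lemma dual_balanced_step (theta : bool) A Cw Cs z : dual_balanced z ->
  dual_balanced (step theta A Cw Cs z).
Proof.
case: theta => //; rewrite /dual_balanced => H.
set cw := fun i => Cw i (gap A (hatw z i) (haty z)).
set cs := Cs (gap A (hats z) (haty z)).
set b := p * k%:R / (2 * d%:R * gamma).
rewrite -[us _]/(us z + (b * eta) *: (n%:R^-1 *: \sum_i cw i)
  - (b * (eta + eta)) *: cs) -[uy _]/(uy z + kappa *: cs).
have -> : \sum_(i < n) uw (step true A Cw Cs z) i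
  = \sum_i uw z i - kappa *: (\sum_i cw i - n%:R *: cs).
  transitivity (\sum_i (uw z i - kappa *: (cw i - cs))) => //.
  rewrite sumrB -scaler_sumr sumrB; congr (_ - _ *: (_ - _)).
  by rewrite sumr_const card_ord scaler_nat.
(* In the invariant [us] counts twice, which compensates the factor 1/2 in [b]: the increments of
   the three terms then cancel. *)
have -> : kappa = 2 * b * eta.
  rewrite /kappa /b -[2 * d%:R * gamma]mulrA [(2 * _)^-1]invfM.
  by move: (_ * gamma)^-1 => ?; field.
rewrite -[RHS]H; have N0 : n%:R != 0 :> R by rewrite gt_eqF ?ltr0n.
move: (\sum_i uw z i) (us z) (uy z) (\sum_i cw i) cs b {H} => a h y e c b.
apply/rowP => j; rewrite !mxE.
move: (a _ _) (h _ _) (y _ _) (e _ _) (c _ _) => *.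
by field.
Qed.

Hypotheses (d_gt0 : (0 < d)%N) (k_gt0 : (0 < k)%N).
Hypotheses (gamma_gt0 : 0 < gamma) (p_gt0 : 0 < p) (eta_gt0 : 0 < eta).

Let d0 : 0 < d%:R :> R. Proof. by rewrite ltr0n. Qed.
Let k0 : 0 < k%:R :> R. Proof. by rewrite ltr0n. Qed.

(** Twice this product multiplies the cross terms of a communication round. Averaging over coin and
    subset multiplies them by [tau]. *)
Let W_kappa : W * kappa = tau^-1.
Proof. by rewrite /W /kappa /tau; field; rewrite !gt_eqF. Qed.

Let W_kappa2 : W * kappa ^+ 2 = eta / gamma.
Proof. by rewrite /W /kappa; field; rewrite !gt_eqF. Qed.

Lemma lyapunov_coef_gt0 : 0 < W.
Proof. by rewrite /W divr_gt0// ?mulr_gt0// ?exprn_gt0. Qed.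

Lemma lyapunov_ge0 z : 0 <= Psi z.
Proof.
have H (F : 'I_n -> 'rV[R]_d) : 0 <= \sum_i sqnorm (F i).
  by apply: sumr_ge0 => i _; exact: sqnorm_ge0.
rewrite /Psi /lyapunov -/W.
apply: addr_ge0; apply: mulr_ge0.
- by rewrite invr_ge0 ltW.
- by do ?[apply: addr_ge0 | apply: mulr_ge0 | apply: sqnorm_ge0 | apply: H].
- exact/ltW/lyapunov_coef_gt0.
- by do ?[apply: addr_ge0 | apply: mulr_ge0 | apply: sqnorm_ge0 | apply: H].
Qed.

Hypothesis stationary : n%:R^-1 *: (\sum_(i < n) gradient (f i) xstar)
  + 2 *: gradient fs xstar + gradient g xstar = 0.

Definition pairing z j : R :=
  \sum_i (uw z i - gradient (f i) xstar) ord0 j * (hatw z i - xstar) ord0 j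
  + 2 * n%:R * ((us z - gradient fs xstar) ord0 j * (hats z - xstar) ord0 j)
  + n%:R * ((uy z - gradient g xstar) ord0 j * (haty z - xstar) ord0 j).

(** [Psi (step false ...)] is the Lyapunov value after the gradient step alone, before any
    exchange. *)
Lemma step_value_le omega omega_s omega_av A z :
  0 <= omega -> 0 <= omega_s -> 0 <= omega_av ->
  rho * (2 + omega_av + 2 * omega_s) = 1 ->
  eta * (1 + 2 * omega + 2 * omega_s) = rho ->
  dual_balanced z ->
  step_value A z (fun i => gap A (hatw z i) (haty z)) (gap A (hats z) (haty z))
  + (gamma^-1 * (rho ^+ 2 * omega_av / 2) + W * kappa ^+ 2 * omega)
    * (\sum_i sqnorm (gap A (hatw z i) (haty z)))
  + 2 * n%:R * omega_s * (gamma^-1 * rho ^+ 2 + W * kappa ^+ 2)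
    * sqnorm (gap A (hats z) (haty z))
  <= Psi (step false A (fun=> id) id z) - 2 / tau * \sum_(j in A) pairing z j.
Proof.
move=> o0 os0 oa0 H1 H2 bal.
apply: (@round_value_le _ _ _ gamma rho W kappa xstar omega omega_s omega_av eta tau
  A (hatw z) (hats z) (haty z) _ (us z - gradient fs xstar)) => //; first exact: ltW.
move=> j; apply: (balanced_coord n_gt0); move: bal stationary.
rewrite /dual_balanced => B S.
rewrite sumrB; move: (\sum_(i < n) gradient _ _) (\sum_i uw _ _) B S => a b B S.
(* The errors of the control variates are balanced because both the control variates and the
   gradients at [xstar] are. *)
transitivity (0 - 0 : 'rV[R]_d); last by rewrite subrr.
rewrite -{1}B -S !scalerBr; move: (gradient _ _) (gradient _ _) => *.
by rewrite !opprD !addrA; apply/rowP => l; rewrite !mxE; ring.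
Qed.

Variables (mu L : R).
Hypotheses (mu_le_L : mu <= L).
Hypotheses (f_smooth : forall i, smooth L (f i)) (fs_smooth : smooth L fs)
    (g_smooth : smooth L g)
    (f_convex : forall i, strongly_convex mu (f i))
    (fs_convex : strongly_convex mu fs) (g_convex : strongly_convex mu g).

Let c0 : R := Num.max ((1 - gamma * mu) ^+ 2) ((1 - gamma * L) ^+ 2).

(* [(1/gamma) |w + gamma v|^2 - 2 <v, w + gamma v> = (1/gamma) |w|^2 - gamma |v|^2] *)
Lemma hat_contraction h x u : smooth L h -> strongly_convex mu h ->
  gamma^-1 * sqnorm (hat h x u - xstar)
   - 2 * dotp (u - gradient h xstar) (hat h x u - xstar)
  <= c0 * (gamma^-1 * sqnorm (x - xstar)) - gamma * sqnorm (u - gradient h xstar).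
Proof.
move=> hs hc.
have gi0 : 0 <= gamma^-1 by rewrite invr_ge0 ltW.
have := ler_wpM2l gi0 (gradient_step_contraction hs x xstar hc mu_le_L gamma_gt0).
set w := _ - _; set v := u - _.
have -> : hat h x u - xstar = w + gamma *: v.
  rewrite /hat /w /v; move: (gradient _ _) (gradient _ _) => a b.
  by apply/rowP => j; rewrite !mxE; ring.
rewrite mulrCA -/c0; move: (c0 * _) => B.
clearbody w v; rewrite -!dotpp !dotpE [dotp v w]dotpC.
set a := dotp w w; set b := dotp w v; set e := dotp v v => H.
suff -> : gamma^-1 * (a + gamma * b + gamma * (b + gamma * e))
  - 2 * (b + gamma * e) = gamma^-1 * a - gamma * e by lra.
by field; rewrite gt_eqF.
Qed.

(** [hat_contraction] is summed with weights 1 for each worker, [2 n] for [s] and [n] for [y]. The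
    distances acquire the factor [c0], while the weight of the control variates drops from [W] to
    [W - gamma]. *)
Lemma local_step_le A z :
  Psi (step false A (fun=> id) id z) - 2 * \sum_j pairing z j
    <= rate (d := d) gamma mu L eta p k * Psi z.
Proof.
have N0 : 0 < n%:R :> R by rewrite ltr0n.
rewrite big_split/= big_split/= exchange_big/= -!mulr_sumr -!/(dotp _ _).
have -> : Psi (step false A (fun=> id) id z) =
  gamma^-1 * ((\sum_i sqnorm (hatw z i - xstar))
    + 2 * n%:R * sqnorm (hats z - xstar) + n%:R * sqnorm (haty z - xstar))
  + W * ((\sum_i sqnorm (uw z i - gradient (f i) xstar))
         + n%:R * sqnorm (uy z - gradient g xstar)) by [].
set c := rate _ _ _ _ _ _.
have cc0 : c0 <= c by rewrite /c /rate le_max lexx.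
have cW : W - gamma <= c * W.
  have -> : W - gamma = (1 - p ^+ 2 * k%:R ^+ 2 * eta / d%:R ^+ 2) * W.
    by rewrite /W; field; rewrite !gt_eqF.
  apply: ler_wpM2r; first exact/ltW/lyapunov_coef_gt0.
  by rewrite /c /rate le_max lexx orbT.
have gi0 : 0 <= gamma^-1 by rewrite invr_ge0 ltW.
have Hw : \sum_i (gamma^-1 * sqnorm (hatw z i - xstar)
   - 2 * dotp (uw z i - gradient (f i) xstar) (hatw z i - xstar)) <=
   \sum_i (c0 * (gamma^-1 * sqnorm (xw z i - xstar))
           - gamma * sqnorm (uw z i - gradient (f i) xstar)).
  apply: ler_sum => i _.
  exact: (hat_contraction (xw z i) (uw z i) (f_smooth i) (f_convex i)).
have Hs := hat_contraction (xs z) (us z) fs_smooth fs_convex.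
have Hy := hat_contraction (yy z) (uy z) g_smooth g_convex.
move: Hw; rewrite !sumrB -!mulr_sumr => Hw.
have N2 : 0 <= 2 * n%:R :> R by lra.
have := ler_wpM2l N2 Hs; have := ler_wpM2l (ltW N0) Hy.
rewrite /Psi /lyapunov -/W.
have s0 := sqnorm_ge0 (us z - gradient fs xstar).
have sumge0 (F : 'I_n -> 'rV[R]_d) : 0 <= \sum_i sqnorm (F i).
  by apply: sumr_ge0 => i _; exact: sqnorm_ge0.
have u0 := addr_ge0 (sumge0 (fun i => uw z i - gradient (f i) xstar))
  (mulr_ge0 (ltW N0) (sqnorm_ge0 (uy z - gradient g xstar))).
have x0 := mulr_ge0 gi0 (addr_ge0 (addr_ge0 (sumge0 (fun i => xw z i - xstar))
  (mulr_ge0 N2 (sqnorm_ge0 (xs z - xstar))))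
  (mulr_ge0 (ltW N0) (sqnorm_ge0 (yy z - xstar)))).
have := ler_wpM2r x0 cc0; have := ler_wpM2r u0 cW.
(* The gain in the error of [us] is discarded, as [Psi] has no such term. *)
have := mulr_ge0 (mulr_ge0 N2 (ltW gamma_gt0)) s0.
have eqd : \sum_i \sum_j (uw z i - gradient (f i) xstar) ord0 j
    * (hatw z i - xstar) ord0 j =
    \sum_i dotp (uw z i - gradient (f i) xstar) (hatw z i - xstar) by [].
rewrite eqd -/(hats z) -/(haty z) -/(dotp (us z - gradient fs xstar) (hats z - xstar)).
rewrite -/(dotp (uy z - gradient g xstar) (haty z - xstar)).
move: Hw; clearbody W c c0.
move: (\sum_i _) (\sum_i _) (\sum_i _) (\sum_i _) => *; lra.
Qed.

End Step.

(** * Measurability and independence *)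

Section VectorMeasurability.
Context {R : realType} {n d : nat} {dX : measure_display}
  {X : measurableType dX}.

(** Measurability for the product sigma-algebra, the one used in [jointly_measurable]. *)
Definition vmeasurable (x : X -> 'rV[R]_d) : Prop :=
  forall j, measurable_fun [set: X] (fun u => x u ord0 j).

Lemma vmeasurable_cst c : vmeasurable (fun=> c).
Proof. by move=> j; exact: measurable_cst. Qed.

Lemma vmeasurableD x y : vmeasurable x -> vmeasurable y ->
  vmeasurable (fun u => x u + y u).
Proof.
move=> mx my j; under eq_fun do rewrite mxE.
by apply: measurable_funD; [exact: mx|exact: my].
Qed.

Lemma vmeasurableZ c x : vmeasurable x -> vmeasurable (fun u => c *: x u).
Proof.
move=> mx j; under eq_fun do rewrite mxE.
by apply: measurable_funM; [exact: measurable_cst|exact: mx].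
Qed.

Lemma vmeasurableN x : vmeasurable x -> vmeasurable (fun u => - x u).
Proof. by move=> mx j; under eq_fun do rewrite mxE; exact: measurableT_comp. Qed.

Lemma vmeasurableB x y : vmeasurable x -> vmeasurable y ->
  vmeasurable (fun u => x u - y u).
Proof. by move=> mx my; apply: vmeasurableD => //; exact: vmeasurableN. Qed.

Lemma vmeasurable_sum (x : 'I_n -> X -> 'rV[R]_d) :
  (forall i, vmeasurable (x i)) -> vmeasurable (fun u => \sum_i x i u).
Proof.
by move=> mx j; under eq_fun do rewrite summxE; apply: measurable_sum => i; exact: mx.
Qed.

Lemma vmeasurable_restrict A x : vmeasurable x ->
  vmeasurable (fun u => restrict_coords A (x u)).
Proof.
move=> mx j; under eq_fun do rewrite mxE.
by case: (j \in A); [exact: mx|exact: measurable_cst].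
Qed.

Lemma vmeasurable_merge A x y : vmeasurable x -> vmeasurable y ->
  vmeasurable (fun u => merge_coords A (x u) (y u)).
Proof.
move=> mx my j; under eq_fun do rewrite mxE.
by case: (j \in A); [exact: mx|exact: my].
Qed.

Lemma measurable_sqnorm x : vmeasurable x ->
  measurable_fun [set: X] (fun u => sqnorm (x u)).
Proof. by move=> mx; apply: measurable_sum => j; apply: measurable_funX; exact: mx. Qed.

Definition grid (m : nat) (x : 'rV[R]_d) : 'rV[int]_d :=
  \row_j Num.floor (m.+1%:R * x ord0 j).

Definition ungrid (m : nat) (v : 'rV[int]_d) : 'rV[R]_d :=
  \row_j ((v ord0 j)%:~R / m.+1%:R).

Lemma cvg_grid (x : 'rV[R]_d) : ungrid m (grid m x) @[m --> \oo] --> x.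
Proof.
apply/(@pseudometric_normed_Zmodule.cvgrPdist_le R) => e e0.
near=> m.
rewrite [leLHS]/Num.norm /= mx_normrE; apply: bigmax_le; first exact: ltW.
move=> [i j] _ /=; rewrite ord1 !mxE.
have m0 : 0 < m.+1%:R :> R by rewrite ltr0n.
apply: (@le_trans _ _ m.+1%:R^-1); last first.
  by apply: ltW; near: m; exact: (near_infty_natSinv_lt (PosNum e0)).
have /andP[l u] := floor_itv (m.+1%:R * x ord0 j).
have -> : x 0 j - (Num.floor (m.+1%:R * x ord0 j))%:~R / m.+1%:R =
  m.+1%:R^-1 * (m.+1%:R * x ord0 j - (Num.floor (m.+1%:R * x ord0 j))%:~R).
  by rewrite mulrBr mulKf ?lt0r_neq0// [_ / _]mulrC.
rewrite normrM [`|_^-1|]ger0_norm ?invr_ge0// ger_pMr ?invr_gt0//.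
rewrite ger0_norm ?subr_ge0//; move: u; rewrite intrD1; lra.
Unshelve. all: by end_near. Qed.

Lemma measurable_grid m x v : vmeasurable x ->
  measurable ((fun u => grid m (x u)) @^-1` [set v]).
Proof.
move=> mx.
have -> : (fun u => grid m (x u)) @^-1` [set v] =
  \bigcap_(j in [set: 'I_d]) ((fun u => m.+1%:R * x u ord0 j) @^-1`
     `[(v ord0 j)%:~R, ((v ord0 j) + 1)%:~R[%classic).
  apply/seteqP; split=> u /=.
    by move=> <- j _ /=; rewrite in_itv/= mxE; exact: floor_itv.
  move=> H; apply/rowP => j; rewrite mxE; apply/eqP; rewrite floor_eq.
  by have := H j I; rewrite /= in_itv.
apply: fin_bigcap_measurable; first exact: finite_finset.
move=> j _; rewrite -[X in measurable X]setTI.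
have mf : measurable_fun [set: X] (fun u => m.+1%:R * x u ord0 j).
  by apply: measurable_funM; [exact: measurable_cst|exact: mx].
by apply: mf => //; exact: measurable_itv.
Qed.

(* A continuous function is the pointwise limit of its values on finer and
   finer grids, each of which takes countably many values. *)
Lemma measurable_continuous (h : 'rV[R]_d -> R) x : continuous h ->
  vmeasurable x -> measurable_fun [set: X] (fun u => h (x u)).
Proof.
move=> ch mx; apply: (@measurable_fun_cvg _ _ _ _
    (fun m u => h (ungrid m (grid m (x u))))).
  move=> m _ B mB; rewrite setTI.
  have -> : (fun u => h (ungrid m (grid m (x u)))) @^-1` B =
    \bigcup_(v : 'rV[int]_d) (if v \in [set v | B (h (ungrid m v))]
      then (fun u => grid m (x u)) @^-1` [set v] else set0).
    apply/seteqP; split=> u /=.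
      by move=> Bu; exists (grid m (x u)) => //; rewrite mem_set.
    by case=> v _; case: ifPn => //; rewrite inE/= => Bv ->.
  apply: countable_bigcupT_measurable; first exact: countableP.
  move=> v; case: ifPn => _; first exact: measurable_grid.
  exact: measurable0.
by move=> u _; apply: continuous_cvg; [exact: ch|exact: cvg_grid].
Qed.

Lemma vmeasurable_gradient L f x : smooth L f -> vmeasurable x ->
  vmeasurable (fun u => gradient f (x u)).
Proof.
move=> Lf mx j.
exact: (@measurable_continuous (fun x => gradient f x ord0 j) x
  (@gradient_continuous _ _ _ _ Lf j) mx).
Qed.

(** Stated through the level sets of [a], so that it applies to the random subset, whose type is
    merely finite. *)
Lemma measurable_finite_index (I : finType) (a : X -> I) (h : I -> X -> R) :
  (forall i, measurable (a @^-1` [set i])) ->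
  (forall i, measurable_fun [set: X] (h i)) ->
  measurable_fun [set: X] (fun u => h (a u) u).
Proof.
move=> ma mh.
have -> : (fun u => h (a u) u) = (fun u => \sum_i \1_(a @^-1` [set i]) u * h i u).
  apply/funext => u; rewrite (bigD1 (a u))//= indicE mem_set// mul1r big1 ?addr0//.
  move=> i /negP ai; rewrite indicE memNset ?mul0r//= => E; apply: ai.
  by rewrite E.
by apply: measurable_sum => i; apply: measurable_funM => //; exact: measurable_indic.
Qed.

End VectorMeasurability.

(** * Independence of a fresh source from the past *)

Section Independence.
Context {R : realType} {dT : measure_display} {T : measurableType dT}.
Variables (P : probability T R) (E : nat -> set (set T)).
Hypotheses (E_meas : forall j, E j `<=` measurable)
  (E_setT : forall j, E j setT) (E_setC : forall j B, E j B -> E j (~` B))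
  (E_setI : forall j, setI_closed (E j)).
Hypothesis E_indep : forall m (B : nat -> set T), (forall j, E j (B j)) ->
  P (\bigcap_(j in `I_m) B j) = (\prod_(j < m) P (B j))%E.

Definition past m : set (set T) :=
  [set A | exists B, (forall j, E j (B j)) /\ A = \bigcap_(j in `I_m) B j].

Lemma past_measurable m : past m `<=` measurable.
Proof.
move=> _ [B [EB ->]]; apply: bigcap_measurableType => j _.
exact/E_meas/EB.
Qed.

Lemma past_setI m : setI_closed (past m).
Proof.
move=> _ _ [B [EB ->]] [C [EC ->]]; exists (fun j => B j `&` C j); split.
  by move=> j; exact: E_setI.
by rewrite bigcapI.
Qed.

Lemma sub_past m j : (j < m)%N -> E j `<=` past m.
Proof.
move=> jm B EB; exists (fun i => if i == j then B else setT); split.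
  by move=> i; case: eqP => [->|_]//.
apply/seteqP; split=> [u Bu i _|u /(_ j jm)]; last by rewrite eqxx.
by case: ifP.
Qed.

(** The sample space with the sigma-algebra of the sources of index below [m]. As a type of its own
    it can be a factor of a product, where Tonelli applies. *)
Definition pastType m := g_sigma_algebraType (past m).

Lemma pastType_measurable m (A : set T) :
  measurable (A : set (pastType m)) -> measurable A.
Proof.
by apply: smallest_sub; [exact: sigma_algebra_measurable|exact: past_measurable].
Qed.

(** For fixed [B], the finite measures [P (A & B)] and [P A * P B] of [A] agree on [past m], which
    is closed under intersection; hence they agree on the generated sigma-algebra. *)
Lemma past_indep m (A B : set T) : measurable (A : set (pastType m)) -> E m B ->
  P (A `&` B) = (P A * P B)%E.
Proof.
move=> mA EB; have mB := E_meas EB.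
have PB : P B = (fine (P B))%:E by rewrite fineK// fin_num_measure.
have PB0 : 0 <= fine (P B) by rewrite fine_ge0.
pose m1 : {measure set T -> \bar R} := mrestr P mB.
pose m2 : {measure set T -> \bar R} := mscale (NngNum PB0) P.
suff : m1 A = m2 A.
  by rewrite /m1/= /mrestr /m2/= /mscale/= -PB muleC.
apply: (@g_sigma_algebra_measure_unique _ _ _ (past m) (@past_measurable m)
  (fun=> setT)) => //.
- by move=> _; exists (fun=> setT); split => //; rewrite bigcapT.
- by rewrite bigcup_const.
- exact: past_setI.
- move=> _ [C [EC ->]]; rewrite /m1/= /mrestr /m2/= /mscale/= -PB.
  pose D j := if j == m then B else C j.
  have ED j : E j (D j) by rewrite /D; case: eqP => [->|].
  have Dm : D m = B by rewrite /D eqxx.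
  have Dj j : (j < m)%N -> D j = C j by rewrite /D => jm; rewrite ltn_eqF.
  have := E_indep m.+1 ED; rewrite big_ord_recr/= Dm.
  under eq_bigr => j _ do rewrite Dj//.
  rewrite -E_indep// muleC => <-; congr (P _).
  apply/seteqP; split => [u [Cu Bu] j /=|u Du].
    rewrite ltnS leq_eqVlt => /orP[/eqP ->|jm]; first by rewrite Dm.
    by rewrite Dj//; exact: Cu.
  split=> [j jm|]; last by have := Du m (ltnSn m); rewrite Dm.
  by have := Du j (leqW jm); rewrite Dj.
- by move=> _; rewrite /m1/= /mrestr setTI ltey_eq fin_num_measure.
Qed.

Lemma measurable_id_past m : measurable_fun [set: T] (fun s => s : pastType m).
Proof. by move=> _ A mA; rewrite setTI; exact: pastType_measurable mA. Qed.

Lemma measurable_fun_past m dW (W : measurableType dW) (H : pastType m -> W) :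
  measurable_fun [set: pastType m] H -> measurable_fun [set: T] (H : T -> W).
Proof. by move=> mH; exact: (measurableT_comp mH (@measurable_id_past m)). Qed.

Section Decoupling.
Context {dV : measure_display} {V : measurableType dV} (m : nat).
Variables (Y : T -> V).
Hypotheses (mY : measurable_fun [set: T] Y)
  (EY : forall N, measurable N -> E m (Y @^-1` N)).
Variable F : pastType m * V -> \bar R.
Hypotheses (mF : measurable_fun [set: pastType m * V] F)
  (F_ge0 : forall x, (0 <= F x)%E).

(** By [past_indep] the joint law of the past and [Y] is the product of their laws. The law of the
    past is the image of [P] under the identity from [T] to [pastType m]. *)
Lemma decoupling :
  (\int[P]_s F (s, Y s) = \int[P]_s1 \int[P]_s2 F (s1, Y s2))%E.
Proof.
have mid := @measurable_id_past m.
have mpair : measurable_fun [set: T] (fun s => (s : pastType m, Y s)).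
  exact: measurable_fun_pair.
pose id1 : {mfun T >-> pastType m} :=
  HB.pack (fun s : T => s : pastType m) (isMeasurableFun.Build _ _ _ _ _ mid).
pose Y1 : {mfun T >-> V} := HB.pack Y (isMeasurableFun.Build _ _ _ _ _ mY).
pose pair1 : {mfun T >-> (pastType m * V)%type} :=
  HB.pack (fun s => (s : pastType m, Y s)) (isMeasurableFun.Build _ _ _ _ _ mpair).
transitivity (\int[distribution P pair1]_z F z)%E.
  by rewrite ge0_integral_distribution.
transitivity (\int[distribution P id1 \x distribution P Y1]_z F z)%E.
  apply: eq_measure_integral => A mA _; apply/esym.
  apply: product_measure_unique => //= M N mM mN.
  exact: (past_indep mM (EY mN)).
rewrite fubini_tonelli1// ge0_integral_distribution//.
- apply: eq_integral => s _; rewrite /fubini_F/=.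
  rewrite (@ge0_integral_distribution _ _ _ _ _ P Y1 (fun y => F (s, y)))//.
  exact: (measurableT_comp mF (measurable_fun_pair (measurable_cst (s : pastType m))
    (@measurable_id _ _ setT))).
- exact: measurable_fun_fubini_tonelli_F.
- by move=> s; exact: integral_ge0.
Qed.

(** In the inner integral the past is frozen, so a bound valid for deterministic arguments can be
    used there. *)
Lemma decoupling_le (G : T -> \bar R) : measurable_fun [set: T] G ->
  (forall s1, \int[P]_s2 F (s1, Y s2) <= G s1)%E ->
  (\int[P]_s F (s, Y s) <= \int[P]_s G s)%E.
Proof.
move=> mG FG; rewrite decoupling; apply: ge0_le_integral => //.
  by move=> s _; exact: integral_ge0.
pose Y1 : {mfun T >-> V} := HB.pack Y (isMeasurableFun.Build _ _ _ _ _ mY).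
have -> : (fun s1 => \int[P]_s2 F (s1, Y s2))%E
    = (fun s : pastType m => fubini_F (distribution P Y1) F s).
  apply/funext => s; rewrite /fubini_F.
  rewrite (@ge0_integral_distribution _ _ _ _ _ P Y1 (fun y => F (s, y)))//.
  exact: (measurableT_comp mF (measurable_fun_pair (measurable_cst (s : pastType m))
    (@measurable_id _ _ setT))).
by apply: measurable_fun_past; exact: measurable_fun_fubini_tonelli_F.
Qed.

End Decoupling.

Lemma integral_past_indicator m B (H : pastType m -> \bar R) : E m B ->
  measurable_fun [set: pastType m] H -> (forall s, 0 <= H s)%E ->
  (\int[P]_s ((\1_B s)%:E * H s) = P B * \int[P]_s H s)%E.
Proof.
move=> EB mH H0; have mB := E_meas EB.
pose Y (s : T) : bool := s \in B.
have YE (N : set bool) : E m (Y @^-1` N).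
  have [Nt|Nt] := pselect (N true); have [Nf|Nf] := pselect (N false).
  - rewrite (_ : _ @^-1` _ = setT)//.
    by apply/seteqP; split=> // u _ /=; case: (Y u).
  - rewrite (_ : _ @^-1` _ = B)//; apply/seteqP; split=> u /=; rewrite /Y.
      by case: (boolP (u \in B)) => [|_ /Nf//]; rewrite inE.
    by move=> Bu; rewrite mem_set.
  - rewrite (_ : _ @^-1` _ = ~` B); first exact: E_setC.
    apply/seteqP; split=> u /=; rewrite /Y.
      by case: (boolP (u \in B)) => [_ /Nt//|]; rewrite notin_setE.
    by move=> Bu; rewrite memNset.
  - rewrite (_ : _ @^-1` _ = ~` setT); first exact: E_setC.
    by rewrite setCT; apply/seteqP; split=> u //=; case: (Y u).
have mY : measurable_fun [set: T] Y.
  by move=> _ N _; rewrite setTI; apply: (@E_meas m); exact: YE.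
pose F (z : pastType m * bool) : \bar R := ((z.2%:R : R)%:E * H z.1)%E.
have mF : measurable_fun [set: pastType m * bool] F.
  apply: emeasurable_funM.
    apply/measurable_EFinP.
    exact: (@measurableT_comp _ _ _ _ _ _ (fun b : bool => b%:R : R) _ snd).
  exact: measurableT_comp.
have F0 z : (0 <= F z)%E by rewrite mule_ge0// lee_fin.
transitivity (\int[P]_s F (s, Y s))%E.
  by apply: eq_integral => s _; rewrite /F/= indicE.
rewrite (@decoupling _ _ m Y mY (fun N _ => YE N) F mF F0).
transitivity (\int[P]_s (P B * H s))%E; last first.
  by rewrite ge0_integralZl//; exact: measurable_fun_past.
apply: eq_integral => s _; rewrite /F/= muleC.
under eq_integral do rewrite muleC.
rewrite ge0_integralZl//.
- congr (_ * _)%E; transitivity (\int[P]_u (\1_B u)%:E)%E.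
    by apply: eq_integral => u _; rewrite indicE.
  by rewrite integral_indic// setIT.
- apply/measurable_EFinP.
  exact: (@measurableT_comp _ _ _ _ _ _ (fun b : bool => b%:R : R) _ Y).
Qed.

Lemma measurable_past m j B : (j < m)%N -> E j B ->
  measurable (B : set (pastType m)).
Proof. by move=> jm EB; apply: sub_sigma_algebra; exact: (sub_past jm EB). Qed.

(** Decoupling for a source with finitely many values, here the coin and the subset: the integrand
    is split along the events [a = i], each independent of the past. *)
Lemma integral_finite_source m (I : finType) (a : T -> I) (w : I -> R)
    (H : I -> pastType m -> R) :
  (forall i, E m (a @^-1` [set i])) ->
  (forall i, P (a @^-1` [set i]) = (w i)%:E) ->
  (forall i, measurable_fun [set: pastType m] (H i)) -> (forall i s, 0 <= H i s) ->
  (\int[P]_s (H (a s) s)%:E = \int[P]_s (\sum_i w i * H i s)%:E)%E.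
Proof.
move=> Ea Pa mH H0.
have mHT i : measurable_fun [set: T] (H i : T -> R) by exact: measurable_fun_past.
have w0 i : 0 <= w i by rewrite -lee_fin -Pa measure_ge0.
transitivity (\int[P]_s (\sum_i ((\1_(a @^-1` [set i]) s)%:E * (H i s)%:E))%E)%E.
  apply: eq_integral => s _; rewrite (bigD1 (a s))//= indicE mem_set// mul1e.
  rewrite big1 ?adde0// => i /negP ai; rewrite indicE memNset ?mul0e//= => E'.
  by apply: ai; rewrite E'.
rewrite ge0_integral_sum//; last 2 first.
- move=> i; apply: emeasurable_funM; apply/measurable_EFinP => //.
  by apply: measurable_indic; exact: E_meas (Ea i).
- by move=> i s _; rewrite mule_ge0// lee_fin.
transitivity (\int[P]_s (\sum_i (w i * H i s)%:E)%E)%E; last first.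
  by apply: eq_integral => s _; rewrite sumEFin.
rewrite ge0_integral_sum//; last 2 first.
- by move=> i; apply/measurable_EFinP; apply: measurable_funM.
- by move=> i s _; rewrite lee_fin mulr_ge0.
apply: eq_bigr => i _; rewrite (integral_past_indicator (Ea i) (H := EFin \o H i)).
- under [in RHS]eq_integral do rewrite EFinM.
  rewrite ge0_integralZl ?Pa//; first exact/measurable_EFinP.
    by move=> s _; rewrite lee_fin.
  by rewrite lee_fin.
- exact/measurable_EFinP.
- by move=> s; rewrite lee_fin.
Qed.

End Independence.

(** * Means and second moments of random vectors *)

Section Mean.
Context {R : realType} {dT : measure_display} {T : measurableType dT}.
Variable P : probability T R.
Implicit Types (X Y : T -> R) (u v c : R).

Definition has_mean X v : Prop :=
  P.-integrable [set: T] (EFin \o X) /\ (\int[P]_s (X s)%:E = v%:E)%E.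

(** A finite mean is required, and not just a bound on the integral, so that sums with terms of no
    fixed sign can be handled. *)
Definition mean_le X c : Prop := exists2 v, has_mean X v & v <= c.

Lemma has_mean_cst c : has_mean (fun=> c) c.
Proof.
split; first exact: finite_measure_integrable_cst.
by rewrite integral_cst//= probability_setT mule1.
Qed.

Lemma has_meanD X Y u v : has_mean X u -> has_mean Y v ->
  has_mean (fun s => X s + Y s) (u + v).
Proof.
move=> [iX EX] [iY EY]; split; first exact: (integrableD measurableT iX iY).
by under eq_integral do rewrite EFinD; rewrite integralD// EX EY.
Qed.

Lemma has_meanZ a X u : has_mean X u -> has_mean (fun s => a * X s) (a * u).
Proof.
move=> [iX EX]; split; first exact: (integrableZl measurableT a iX).
by under eq_integral do rewrite EFinM; rewrite integralZl// EX.
Qed.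

Lemma has_mean_sum (I : Type) (s : seq I) (X : I -> T -> R) (u : I -> R) :
  (forall i, has_mean (X i) (u i)) ->
  has_mean (fun w => \sum_(i <- s) X i w) (\sum_(i <- s) u i).
Proof.
move=> H; elim: s => [|i s IH].
  by under eq_fun do rewrite big_nil; rewrite big_nil; exact: has_mean_cst.
under eq_fun do rewrite big_cons; rewrite big_cons; exact: has_meanD.
Qed.

Lemma mean_le_cst c : mean_le (fun=> c) c.
Proof. by exists c => //; exact: has_mean_cst. Qed.

Lemma mean_leD X Y u v : mean_le X u -> mean_le Y v ->
  mean_le (fun s => X s + Y s) (u + v).
Proof.
move=> [a ha au] [b hb bv]; exists (a + b); first exact: has_meanD.
exact: lerD.
Qed.

Lemma mean_leZ a X u : 0 <= a -> mean_le X u -> mean_le (fun s => a * X s) (a * u).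
Proof.
move=> a0 [v hv vu]; exists (a * v); first exact: has_meanZ.
exact: ler_wpM2l.
Qed.

Lemma mean_le_sum (I : Type) (s : seq I) (X : I -> T -> R) (u : I -> R) :
  (forall i, mean_le (X i) (u i)) ->
  mean_le (fun w => \sum_(i <- s) X i w) (\sum_(i <- s) u i).
Proof.
move=> H; elim: s => [|i s IH].
  by under eq_fun do rewrite big_nil; rewrite big_nil; exact: mean_le_cst.
under eq_fun do rewrite big_cons; rewrite big_cons; exact: mean_leD.
Qed.

Context {d : nat}.
Implicit Types (C : T -> 'rV[R]_d).

Section SecondMoment.
Variables (C : T -> 'rV[R]_d) (m : 'rV[R]_d) (V : R).
Hypotheses (mC : vmeasurable C)
  (EC : forall j, (\int[P]_s (C s ord0 j)%:E = (m ord0 j)%:E)%E)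
  (VC : (\int[P]_s (sqnorm (C s - m))%:E <= V%:E)%E).

Lemma deviation_mean : mean_le (fun s => sqnorm (C s - m)) V.
Proof.
have mS : measurable_fun [set: T] (fun s => sqnorm (C s - m)).
  by apply: measurable_sqnorm; apply: vmeasurableB => //; exact: vmeasurable_cst.
have fin : (\int[P]_s (sqnorm (C s - m))%:E)%E \is a fin_num.
  rewrite ge0_fin_numE; first exact: le_lt_trans VC (ltry _).
  by apply: integral_ge0 => s _; rewrite lee_fin sqnorm_ge0.
exists (fine (\int[P]_s (sqnorm (C s - m))%:E)%E); last first.
  by rewrite -lee_fin fineK.
split; last by rewrite fineK.
apply/integrableP; split; first exact/measurable_EFinP.
under eq_integral => s _ do rewrite /= ger0_norm ?sqnorm_ge0//.
exact: le_lt_trans VC (ltry _).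
Qed.

(** Integrability comes from the second moment: by [x <= 1 + x ^+ 2] the coordinate is dominated by
    a constant plus the squared deviation. *)
Lemma coord_mean j : has_mean (fun s => C s ord0 j) (m ord0 j).
Proof.
split; last exact: EC.
have [v hS _] := deviation_mean.
have iB : P.-integrable [set: T]
    (EFin \o (fun s => (1 + `|m ord0 j|) + sqnorm (C s - m))).
  by case: (has_meanD (has_mean_cst (1 + `|m ord0 j|)) hS).
apply: le_integrable iB => //; first exact/measurable_EFinP/mC.
move=> s _; rewrite /= lee_fin.
have s0 : 0 <= sqnorm (C s - m) by exact: sqnorm_ge0.
rewrite [leRHS]ger0_norm; last by rewrite !addr_ge0.
have -> : C s ord0 j = m ord0 j + (C s - m) ord0 j by rewrite !mxE; ring.
apply: le_trans (ler_normD _ _) _.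
have : (C s - m) ord0 j ^+ 2 <= sqnorm (C s - m).
  by rewrite /sqnorm (bigD1 j)//= lerDl; apply: sumr_ge0 => i _; exact: sqr_ge0.
rewrite -real_normK ?num_real//; move: `|(C s - m) _ _| (normr_ge0 ((C s - m) ord0 j)).
by move=> x x0; nra.
Qed.

(** Bias-variance decomposition: the square is expanded around [a + b *: m] and the cross term has
    mean 0. *)
Lemma mean_le_sqnorm a b :
  mean_le (fun s => sqnorm (a + b *: C s)) (sqnorm (a + b *: m) + b ^+ 2 * V).
Proof.
have -> : (fun s => sqnorm (a + b *: C s)) =
   (fun s => (sqnorm (a + b *: m)
      + \sum_(j < d) 2 * b * (a + b *: m) ord0 j * (C s ord0 j + - m ord0 j))
      + b ^+ 2 * sqnorm (C s - m)).
  apply/funext => s; rewrite /sqnorm mulr_sumr -!big_split/=.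
  by apply: eq_bigr => j _; rewrite !mxE; ring.
apply: mean_leD; last by apply: mean_leZ; [exact: sqr_ge0|exact: deviation_mean].
exists (sqnorm (a + b *: m)) => //.
have E0 : sqnorm (a + b *: m) = sqnorm (a + b *: m)
    + \sum_(j < d) 2 * b * (a + b *: m) ord0 j * (m ord0 j + - m ord0 j).
  by rewrite big1 ?addr0// => j _; rewrite subrr mulr0.
rewrite [X in has_mean _ X]E0; apply: (has_meanD (has_mean_cst _)).
apply: has_mean_sum => j; apply: has_meanZ; apply: has_meanD.
  exact: coord_mean.
exact: has_mean_cst.
Qed.

End SecondMoment.
End Mean.

(** * Measurability of one step *)

Section StepMeasurability.
Context {R : realType} {n d k : nat} {dX : measure_display}
  {X : measurableType dX}.
Implicit Types (Z : X -> state R n d).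

Definition smeasurable Z : Prop :=
  [/\ [/\ forall i, vmeasurable (fun x => xw (Z x) i),
      vmeasurable (fun x => xs (Z x)) & vmeasurable (fun x => yy (Z x))],
      forall i, vmeasurable (fun x => uw (Z x) i),
      vmeasurable (fun x => us (Z x)) & vmeasurable (fun x => uy (Z x))].

(** A compressor is evaluated at a vector that itself varies with the outcome; joint measurability
    provides this stability. *)
Definition measurable_map (C : X -> 'rV[R]_d -> 'rV[R]_d) : Prop :=
  forall y, vmeasurable y -> vmeasurable (fun x => C x (y x)).

Variables (f : 'I_n -> 'rV[R]_d -> R) (fs g : 'rV[R]_d -> R).
Variables (L gamma eta eta_y rho rho_y p : R).
Hypotheses (f_smooth : forall i, smooth L (f i)) (fs_smooth : smooth L fs)
    (g_smooth : smooth L g).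

Lemma vmeasurable_hat h (x u : X -> 'rV[R]_d) : smooth L h -> vmeasurable x -> vmeasurable u ->
  vmeasurable (fun s : X => hat gamma h (x s) (u s)).
Proof.
move=> hs mx mu; apply: vmeasurableD; last exact: vmeasurableZ.
apply: vmeasurableB => //; apply: vmeasurableZ.
exact: (vmeasurable_gradient hs mx).
Qed.

Lemma vmeasurable_gap A (x y : X -> 'rV[R]_d) : vmeasurable x -> vmeasurable y ->
  vmeasurable (fun s : X => gap A (x s) (y s)).
Proof.
by move=> mx my; apply: vmeasurableB; apply: vmeasurable_restrict.
Qed.

Variables (Z : X -> state R n d) (theta : X -> bool) (A : X -> {set 'I_d})
  (Cw : X -> {set 'I_d} -> 'I_n -> 'rV[R]_d -> 'rV[R]_d)
  (Cs : X -> {set 'I_d} -> 'rV[R]_d -> 'rV[R]_d).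
Hypotheses (mZ : smeasurable Z) (mtheta : measurable_fun [set: X] theta)
  (mA : forall B, measurable (A @^-1` [set B]))
  (mCw : forall B i, measurable_map (fun x => Cw x B i))
  (mCs : forall B, measurable_map (fun x => Cs x B)).

Lemma smeasurable_step :
  smeasurable (fun x => bicolor_step f fs g gamma eta eta_y rho rho_y k p
    (theta x) (A x) (Cw x (A x)) (Cs x (A x)) (Z x)).
Proof.
have [[mxw mxs myy] muw mus muy] := mZ.
set step := bicolor_step f fs g gamma eta eta_y rho rho_y k p.
(* Each component is split along the coin, then along the finitely many subsets. The empty set is a
   placeholder for the subset of a round without communication. *)
have split_case (W : state R n d -> 'rV[R]_d) :
    (forall B, vmeasurable (fun x => W (step true B (Cw x B) (Cs x B) (Z x)))) ->
    vmeasurable (fun x => W (step false finset.set0 (Cw x finset.set0) (Cs x finset.set0) (Z x))) ->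
    vmeasurable (fun x => W (step (theta x) (A x) (Cw x (A x)) (Cs x (A x)) (Z x))).
  move=> H1 H0 j.
  have -> : (fun x => W (step (theta x) (A x) (Cw x (A x)) (Cs x (A x)) (Z x)) ord0 j)
    = (fun x => if theta x then W (step true (A x) (Cw x (A x)) (Cs x (A x)) (Z x)) ord0 j
       else W (step false finset.set0 (Cw x finset.set0) (Cs x finset.set0) (Z x)) ord0 j).
    by apply/funext => x; case: (theta x).
  apply: measurable_fun_ifT => //.
  apply: (@measurable_finite_index _ _ _ _ A
    (fun B x => W (step true B (Cw x B) (Cs x B) (Z x)) ord0 j)) => // B.
  exact: H1.
have mhw i : vmeasurable (fun x => hat gamma (f i) (xw (Z x) i) (uw (Z x) i)).
  exact: (vmeasurable_hat (f_smooth i) (mxw i) (muw i)).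
have mhs : vmeasurable (fun x => hat gamma fs (xs (Z x)) (us (Z x))).
  exact: (vmeasurable_hat fs_smooth mxs mus).
have mhy : vmeasurable (fun x => hat gamma g (yy (Z x)) (uy (Z x))).
  exact: (vmeasurable_hat g_smooth myy muy).
have mc B i : vmeasurable (fun x => Cw x B i
    (gap B (hat gamma (f i) (xw (Z x) i) (uw (Z x) i))
           (hat gamma g (yy (Z x)) (uy (Z x))))).
  by apply: mCw; exact: vmeasurable_gap.
have mcs B : vmeasurable (fun x => Cs x B
    (gap B (hat gamma fs (xs (Z x)) (us (Z x)))
           (hat gamma g (yy (Z x)) (uy (Z x))))).
  by apply: mCs; exact: vmeasurable_gap.
have mcbar B : vmeasurable (fun x => \sum_(i < n) Cw x B i
    (gap B (hat gamma (f i) (xw (Z x) i) (uw (Z x) i))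
           (hat gamma g (yy (Z x)) (uy (Z x))))).
  exact: vmeasurable_sum.
split; first split.
- move=> i; apply: (split_case (fun z => xw z i)) => [B|]; last exact: mhw.
  exact: (vmeasurable_merge B (vmeasurableD (vmeasurableZ _ (mhw i))
    (vmeasurableZ _ (vmeasurableD (mcs B) mhy))) (mhw i)).
- apply: (split_case (fun z => xs z)) => [B|]; last exact: mhs.
  exact: (vmeasurable_merge B (vmeasurableD (vmeasurableD (vmeasurableZ _ mhs)
    (vmeasurableZ _ mhy)) (vmeasurableZ _ (vmeasurableZ _ (mcbar B)))) mhs).
- apply: (split_case (fun z => yy z)) => [B|]; last exact: mhy.
  exact: (vmeasurableD mhy (vmeasurableZ _ (mcs B))).
- move=> i; apply: (split_case (fun z => uw z i)) => [B|]; last exact: muw.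
  exact: (vmeasurableB (muw i) (vmeasurableZ _ (vmeasurableB (mc B i) (mcs B)))).
- apply: (split_case (fun z => us z)) => [B|]; last exact: mus.
  exact: (vmeasurableB (vmeasurableD mus (vmeasurableZ _ (vmeasurableZ _ (mcbar B))))
    (vmeasurableZ _ (mcs B))).
- apply: (split_case (fun z => uy z)) => [B|]; last exact: muy.
  exact: (vmeasurableD muy (vmeasurableZ _ (mcs B))).
Qed.

Lemma measurable_lyapunov xstar :
  measurable_fun [set: X] (fun x => lyapunov f g gamma eta p k xstar (Z x)).
Proof.
have [[mxw mxs myy] muw mus muy] := mZ.
have D (F G : X -> R) : measurable_fun setT F -> measurable_fun setT G ->
  measurable_fun [set: X] (fun x => F x + G x) by exact: measurable_funD.
have M (c : R) (F : X -> R) : measurable_fun setT F ->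
  measurable_fun [set: X] (fun x => c * F x).
  by move=> mF; apply: measurable_funM => //; exact: measurable_cst.
have S (x : X -> 'rV[R]_d) c : vmeasurable x -> measurable_fun [set: X] (fun u => sqnorm (x u - c)).
  by move=> mx; apply: measurable_sqnorm; apply: vmeasurableB => //; exact: vmeasurable_cst.
apply: (D); apply: (M).
  apply: (D); last by apply: M; exact: S.
  apply: (D); last by apply: M; exact: S.
  by apply: measurable_sum => i; exact: S.
apply: (D); last by apply: M; exact: S.
by apply: measurable_sum => i; exact: S.
Qed.

End StepMeasurability.

(** * Expectation of one step *)

Section RoundMean.
Context {R : realType} {dT : measure_display} {T : measurableType dT}.
Context {n d : nat}.
Variable P : probability T R.
Variables (gamma rho W kappa : R) (xstar : 'rV[R]_d).
Hypotheses (n_gt0 : (0 < n)%N) (gamma_ge0 : 0 <= gamma) (W_ge0 : 0 <= W).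
Variables (A : {set 'I_d}) (hw vw : 'I_n -> 'rV[R]_d) (hs hy vy : 'rV[R]_d).

Let value := round_value gamma rho W kappa xstar A hw hs hy vw vy.

Let gi0 : 0 <= gamma^-1. Proof. by rewrite invr_ge0. Qed.
Let N0 : 0 <= n%:R :> R. Proof. by []. Qed.
Let N2 : 0 <= 2 * n%:R :> R. Proof. by rewrite mulr_ge0. Qed.

(** The messages enter [xs] only through their mean, with factor [rho / 2], whence
    [2 n * (rho / 2)^2 * omega_av / n]. They enter each [uw] separately with factor [kappa], whence
    [omega]. No square mixes two workers otherwise, so their dependence is harmless. *)
Lemma mean_round_value_workers (cw : 'I_n -> T -> 'rV[R]_d)
    (delta : 'I_n -> 'rV[R]_d) (cs : 'rV[R]_d) (omega omega_av : R) :
  (forall i, vmeasurable (cw i)) ->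
  (forall i j, (\int[P]_s (cw i s ord0 j)%:E = (delta i ord0 j)%:E)%E) ->
  (forall i, (\int[P]_s (sqnorm (cw i s - delta i))%:E
     <= (omega * sqnorm (delta i))%:E)%E) ->
  (\int[P]_s (sqnorm (n%:R^-1 *: \sum_i (cw i s - delta i)))%:E
     <= (omega_av / n%:R * \sum_i sqnorm (delta i))%:E)%E ->
  mean_le P (fun s => value (fun i => cw i s) cs)
    (value delta cs
     + (gamma^-1 * (rho ^+ 2 * omega_av / 2) + W * kappa ^+ 2 * omega)
       * \sum_i sqnorm (delta i)).
Proof.
move=> mc Ec Vc Vav.
set S := \sum_i sqnorm (delta i).
have mcbar : vmeasurable (fun s => n%:R^-1 *: \sum_i cw i s).
  by apply: vmeasurableZ; apply: vmeasurable_sum => i; exact: mc.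
have Ecbar j : (\int[P]_s ((n%:R^-1 *: \sum_i cw i s) ord0 j)%:E
    = ((n%:R^-1 *: \sum_i delta i) ord0 j)%:E)%E.
  suff [_ <-] : has_mean P (fun s => n%:R^-1 * \sum_i cw i s ord0 j)
      ((n%:R^-1 *: \sum_i delta i) ord0 j).
    by apply: eq_integral => s _; rewrite mxE summxE.
  rewrite mxE summxE; apply: has_meanZ; apply: has_mean_sum => i.
  exact: (coord_mean (mc i) (Ec i) (Vc i)).
have Vcbar : (\int[P]_s (sqnorm (n%:R^-1 *: \sum_i cw i s
     - n%:R^-1 *: \sum_i delta i))%:E <= (omega_av / n%:R * S)%:E)%E.
  apply: le_trans Vav; rewrite le_eqVlt; apply/orP; left; apply/eqP.
  by apply: eq_integral => s _; rewrite sumrB scalerBr.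
have -> : (fun s => value (fun i => cw i s) cs) = (fun s =>
  gamma^-1 * ((\sum_i sqnorm (merge_coords A ((1 - rho) *: hw i + rho *: hy) (hw i)
                     - xstar + rho *: cs))
     + 2 * n%:R * sqnorm (merge_coords A ((1 - rho) *: hs + rho *: hy) hs
                          - xstar + (rho / 2) *: (n%:R^-1 *: \sum_i cw i s))
     + n%:R * sqnorm (hy - xstar + rho *: cs))
  + W * ((\sum_i sqnorm (vw i + kappa *: cs + (- kappa) *: cw i s))
         + n%:R * sqnorm (vy + kappa *: cs))).
  apply/funext => s; rewrite /value /round_value; congr (_ + W * (_ + _)).
  apply: eq_bigr => i _; congr sqnorm.
  by apply/rowP => j; rewrite !mxE; ring.
set K1 := \sum_i _; set K2 := n%:R * _; set K3 := n%:R * _.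
set alpha := _ - xstar.
have B : mean_le P (fun s =>
  gamma^-1 * (K1 + 2 * n%:R * sqnorm (alpha + (rho / 2) *: (n%:R^-1 *: \sum_i cw i s)) + K2)
  + W * ((\sum_i sqnorm (vw i + kappa *: cs + (- kappa) *: cw i s)) + K3))
  (gamma^-1 * (K1 + 2 * n%:R * (sqnorm (alpha + (rho / 2) *: (n%:R^-1 *: \sum_i delta i))
      + (rho / 2) ^+ 2 * (omega_av / n%:R * S)) + K2)
  + W * ((\sum_i (sqnorm (vw i + kappa *: cs + (- kappa) *: delta i)
       + (- kappa) ^+ 2 * (omega * sqnorm (delta i)))) + K3)).
  apply: mean_leD; apply: mean_leZ => //.
    apply: mean_leD; last exact: mean_le_cst.
    apply: mean_leD; first exact: mean_le_cst.
    apply: mean_leZ => //.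
    exact: (mean_le_sqnorm mcbar Ecbar Vcbar alpha (rho / 2)).
  apply: mean_leD; last exact: mean_le_cst.
  apply: mean_le_sum => i.
  exact: (mean_le_sqnorm (mc i) (Ec i) (Vc i) (vw i + kappa *: cs) (- kappa)).
have [v hv le] := B; exists v => //; apply: le_trans le _.
rewrite big_split/= -!mulr_sumr -/S.
have -> : value delta cs = gamma^-1 * (K1 + 2 * n%:R *
     sqnorm (alpha + (rho / 2) *: (n%:R^-1 *: \sum_i delta i)) + K2)
  + W * ((\sum_i sqnorm (vw i + kappa *: cs + (- kappa) *: delta i)) + K3).
  rewrite /value /round_value; congr (_ + W * (_ + _)).
  apply: eq_bigr => i _; congr sqnorm.
  by apply/rowP => j; rewrite !mxE; ring.
have Nn : n%:R != 0 :> R by rewrite pnatr_eq0 -lt0n.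
rewrite le_eqVlt; apply/orP; left; apply/eqP.
move: (sqnorm _) (\sum_i sqnorm _) gamma^-1 => a b q.
by field; exact: Nn.
Qed.

(** The message occurs with factor [rho] in the [n] workers and in [yy], which has weight [n], and
    likewise with factor [kappa] in the control variates: hence [2 n] in both terms. *)
Lemma mean_round_value_server (cw : 'I_n -> 'rV[R]_d) (cs : T -> 'rV[R]_d)
    (delta : 'rV[R]_d) (omega_s : R) :
  vmeasurable cs ->
  (forall j, (\int[P]_s (cs s ord0 j)%:E = (delta ord0 j)%:E)%E) ->
  (\int[P]_s (sqnorm (cs s - delta))%:E <= (omega_s * sqnorm delta)%:E)%E ->
  mean_le P (fun s => value cw (cs s))
    (value cw delta
     + 2 * n%:R * omega_s * (gamma^-1 * rho ^+ 2 + W * kappa ^+ 2)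
       * sqnorm delta).
Proof.
move=> mc Ec Vc.
have M := mean_le_sqnorm mc Ec Vc.
have E c : value cw c = gamma^-1 *
  ((\sum_i sqnorm (merge_coords A ((1 - rho) *: hw i + rho *: hy) (hw i)
                     - xstar + rho *: c))
     + 2 * n%:R * sqnorm (merge_coords A ((1 - rho) *: hs + rho *: hy) hs
                          - xstar + (rho / 2) *: (n%:R^-1 *: \sum_i cw i))
     + n%:R * sqnorm (hy - xstar + rho *: c))
  + W * ((\sum_i sqnorm (vw i - kappa *: cw i + kappa *: c))
         + n%:R * sqnorm (vy + kappa *: c)).
  rewrite /value /round_value; congr (_ + W * (_ + _)).
  apply: eq_bigr => i _; congr sqnorm.
  by apply/rowP => j; rewrite !mxE; ring.
under eq_fun do rewrite E.
set K := 2 * n%:R * sqnorm (_ + (rho / 2) *: _).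
pose V := omega_s * sqnorm delta.
have B : mean_le P (fun s => gamma^-1 *
  ((\sum_i sqnorm (merge_coords A ((1 - rho) *: hw i + rho *: hy) (hw i)
                     - xstar + rho *: cs s)) + K
     + n%:R * sqnorm (hy - xstar + rho *: cs s))
  + W * ((\sum_i sqnorm (vw i - kappa *: cw i + kappa *: cs s))
         + n%:R * sqnorm (vy + kappa *: cs s)))
  (gamma^-1 *
  ((\sum_i (sqnorm (merge_coords A ((1 - rho) *: hw i + rho *: hy) (hw i)
                     - xstar + rho *: delta) + rho ^+ 2 * V)) + K
     + n%:R * (sqnorm (hy - xstar + rho *: delta) + rho ^+ 2 * V))
  + W * ((\sum_i (sqnorm (vw i - kappa *: cw i + kappa *: delta) + kappa ^+ 2 * V))
         + n%:R * (sqnorm (vy + kappa *: delta) + kappa ^+ 2 * V))).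
  apply: mean_leD; apply: mean_leZ => //.
    apply: mean_leD; last by apply: mean_leZ => //; exact: M.
    apply: mean_leD; last exact: mean_le_cst.
    by apply: mean_le_sum => i; exact: M.
  apply: mean_leD; last by apply: mean_leZ => //; exact: M.
  by apply: mean_le_sum => i; exact: M.
have [v hv le] := B; exists v => //; apply: le_trans le _.
have sumc (c : R) : \sum_(i < n) c = n%:R * c.
  by rewrite sumr_const card_ord mulr_natl.
rewrite !big_split/= !sumc [value _ _]E -/K /V.
rewrite le_eqVlt; apply/orP; left; apply/eqP; ring.
Qed.

End RoundMean.

(** * Uniform subsets of fixed size *)

Section SubsetCount.
Context {R : realType} {d k : nat}.
Hypotheses (k_gt0 : (0 < k)%N) (k_le_d : (k <= d)%N).

Definition subset_weight (A : {set 'I_d}) : R :=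
  if #|A| == k then 'C(d, k)%:R^-1 else 0.

Lemma sum_subset_weight (F : {set 'I_d} -> R) :
  \sum_A subset_weight A * F A = 'C(d, k)%:R^-1 * \sum_(A : {set 'I_d} | #|A| == k) F A.
Proof.
rewrite mulr_sumr [RHS]big_mkcond/=; apply: eq_bigr => A _.
by rewrite /subset_weight; case: ifP => // _; rewrite mul0r.
Qed.

Lemma subset_weight_sum1 : \sum_A subset_weight A = 1.
Proof.
under eq_bigr => A _ do rewrite -[subset_weight A]mulr1.
rewrite sum_subset_weight sumr_const.
have -> : #|[pred A : {set 'I_d} | #|A| == k]| = 'C(d, k).
  by rewrite -[in RHS](card_ord d) -card_draws cardsE.
by rewrite mulVf// pnatr_eq0 -lt0n bin_gt0.
Qed.

(** The subsets avoiding [j] are those of its complement; Pascal's rule gives the rest. *)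
Lemma card_subsets_with (j : 'I_d) :
  #|[set A : {set 'I_d} | (#|A| == k) && (j \in A)]%SET| = 'C(d.-1, k.-1).
Proof.
have E1 : #|[set A : {set 'I_d} | #|A| == k]%SET| = 'C(d, k).
  by rewrite card_draws card_ord.
have E2 : #|[set A : {set 'I_d} | (#|A| == k) && (j \notin A)]%SET| = 'C(d.-1, k).
  have := cards_draws [set~ j]%SET k; rewrite cardsC1 card_ord => <-.
  apply: eq_card => A; rewrite !inE andbC; congr (_ && _).
  apply/idP/fintype.subsetP => [jA i iA|H]; last first.
    by apply/negP => /H; rewrite !inE eqxx.
  by rewrite !inE; apply: contraNneq jA => <-.
have := cardsID [set A : {set 'I_d} | j \in A]%SET [set A : {set 'I_d} | #|A| == k]%SET.
rewrite E1 => E3.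
have : #|[set A : {set 'I_d} | (#|A| == k) && (j \in A)]%SET| + 'C(d.-1, k) = 'C(d, k).
  rewrite -E3 -E2; congr (_ + _)%N; apply: eq_card => A; rewrite !inE//.
  exact: andbC.
have d0 : (0 < d)%N by exact: leq_trans k_gt0 k_le_d.
move: #|_| => c; case: (d) (k) d0 k_gt0 => [//|d'] [//|k'] _ _ /=.
by rewrite binS; lia.
Qed.

(** A coordinate is drawn with probability [k / d], by the identity
    [d * 'C(d.-1, k.-1) = k * 'C(d, k)]. *)
Lemma subset_weight_mem (F : 'I_d -> R) :
  \sum_A subset_weight A * (\sum_(j in A) F j) = k%:R / d%:R * \sum_j F j.
Proof.
rewrite sum_subset_weight.
under eq_bigr do rewrite big_mkcond/=.
rewrite exchange_big/= !mulr_sumr; apply: eq_bigr => j _.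
rewrite -big_mkcondr/= sumr_const.
have -> : #|[pred A : {set 'I_d} | (#|A| == k) && (j \in A)]| = 'C(d.-1, k.-1).
  by rewrite -(card_subsets_with j) cardsE.
rewrite -[F j *+ _]mulr_natl mulrA; congr (_ * _).
have d0 : (0 < d)%N by exact: leq_trans k_gt0 k_le_d.
have Ck : 'C(d, k)%:R != 0 :> R by rewrite pnatr_eq0 -lt0n bin_gt0.
have dn : d%:R != 0 :> R by rewrite pnatr_eq0 -lt0n.
have H : (d * 'C(d.-1, k.-1) = k * 'C(d, k))%N.
  case: (d) (k) d0 k_gt0 => [//|d'] [//|k'] _ _ /=.
  exact: mul_bin_diag.
have : d%:R * 'C(d.-1, k.-1)%:R = k%:R * 'C(d, k)%:R :> R by rewrite -!natrM H.
move=> H'; apply: (mulfI dn); rewrite mulrCA H' mulrCA mulVf// mulr1.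
by rewrite mulrCA divff// mulr1.
Qed.

End SubsetCount.

(** * The sources of randomness and their sigma-algebras *)

Section PreimageSystem.
Context {aT rT : Type} (h : aT -> rT) (G : set (set rT)).
Implicit Types B : set aT.

Lemma preimage_set_systemT : G setT -> preimage_set_system setT h G setT.
Proof. by move=> GT; exists setT => //; rewrite setTI preimage_setT. Qed.

Lemma preimage_set_systemC B : (forall N, G N -> G (~` N)) ->
  preimage_set_system setT h G B -> preimage_set_system setT h G (~` B).
Proof.
by move=> GC [N GN <-]; exists (~` N); [exact: GC|rewrite !setTI preimage_setC].
Qed.

Lemma preimage_set_systemI : setI_closed G ->
  setI_closed (preimage_set_system setT h G).
Proof.
move=> GI _ _ [M GM <-] [N GN <-]; exists (M `&` N); first exact: GI.
by rewrite !setTI preimage_setI.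
Qed.

End PreimageSystem.

(* Within a round the sources are listed in the order opposite to the one in
   which they are integrated out. *)
Definition src (m : nat) : source :=
  let t := (m %/ 4)%N in
  match (m %% 4)%N with
  | 0 => CoinAt t | 1 => SubsetAt t | 2 => ServerAt t | _ => WorkersAt t
  end.

Lemma src_inj : injective src.
Proof.
move=> a b E; rewrite (divn_eq a 4) (divn_eq b 4); move: E; rewrite /src.
have := ltn_pmod a (isT : (0 < 4)%N); have := ltn_pmod b (isT : (0 < 4)%N).
move: (a %/ 4)%N (b %/ 4)%N => q q'.
case: (a %% 4)%N => [|[|[|[|?]]]]//; case: (b %% 4)%N => [|[|[|[|?]]]]// _ _ [->]//.
Qed.

Lemma src_coin t : src (4 * t) = CoinAt t.
Proof. by rewrite /src mulKn// modnMr. Qed.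

Lemma src_subset t : src (4 * t + 1) = SubsetAt t.
Proof. by rewrite /src mulnC divnMDl// modnMDl addn0. Qed.

Lemma src_server t : src (4 * t + 2) = ServerAt t.
Proof. by rewrite /src mulnC divnMDl// modnMDl addn0. Qed.

Lemma src_workers t : src (4 * t + 3) = WorkersAt t.
Proof. by rewrite /src mulnC divnMDl// modnMDl addn0. Qed.

Section Sources.
Context {R : realType} {n d : nat}.
Context {dT dW dS : measure_display} {T : measurableType dT}
  {XW : measurableType dW} {XS : measurableType dS}.
Variables (P : probability T R) (r : randomness R n d T XW XS).
Hypothesis r_meas : measurable_randomness r.

Definition events (m : nat) : set (set T) := source_events r (src m).

Lemma source_events_measurable a : source_events r a `<=` measurable.
Proof.
have [mc mA mw ms _] := r_meas; case: a => t _ [B GB <-] /=; rewrite setTI.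
- by rewrite -[X in measurable X]setTI; exact: mc.
- have -> : round_subset r t @^-1` B = \bigcup_(A : {set 'I_d})
     (if A \in B then round_subset r t @^-1` [set A] else set0).
    apply/seteqP; split=> s /=.
      by move=> Bs; exists (round_subset r t s) => //; rewrite mem_set.
    by case=> A _; case: ifPn => //; rewrite inE => BA ->.
  apply: countable_bigcupT_measurable; first exact: countableP.
  by move=> A; case: ifPn => _; [exact: mA|exact: measurable0].
- by rewrite -[X in measurable X]setTI; exact: mw.
- by rewrite -[X in measurable X]setTI; exact: ms.
Qed.

Lemma events_measurable m : events m `<=` measurable.
Proof. exact: source_events_measurable. Qed.

Lemma events_setT m : events m setT.
Proof. by rewrite /events; case: (src m) => t; apply: preimage_set_systemT. Qed.

Lemma events_setC m B : events m B -> events m (~` B).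
Proof.
rewrite /events; case: (src m) => t; apply: preimage_set_systemC => // N mN;
  exact: measurableC.
Qed.

Lemma events_setI m : setI_closed (events m).
Proof.
rewrite /events; case: (src m) => t; apply: preimage_set_systemI => // M N mM mN;
  exact: measurableI.
Qed.

Hypothesis r_indep : independence_assumption P r.

Lemma events_indep m (B : nat -> set T) : (forall j, events j (B j)) ->
  P (\bigcap_(j in `I_m) B j) = (\prod_(j < m) P (B j))%E.
Proof.
move=> EB.
rewrite -(r_indep (s := fun a : 'I_m => src a) (B := fun a : 'I_m => B a)).
- congr (P _); apply/seteqP; split=> [s H a _|s H j jm].
    exact: H (ltn_ord a).
  exact: (H (Ordinal jm) I).
- by move=> a b /src_inj/val_inj.
- by move=> a; exact: EB.
Qed.

Let U := pastType events.

Lemma coin_event t B : events (4 * t) (coin r t @^-1` B).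
Proof. by rewrite /events src_coin; exists B => //; rewrite setTI. Qed.

Lemma subset_event t B : events (4 * t + 1) (round_subset r t @^-1` B).
Proof. by rewrite /events src_subset; exists B => //; rewrite setTI. Qed.

Lemma server_event t B : measurable B -> events (4 * t + 2) (sseed r t @^-1` B).
Proof. by move=> mB; rewrite /events src_server; exists B => //; rewrite setTI. Qed.

Lemma workers_event t B : measurable B -> events (4 * t + 3) (wseed r t @^-1` B).
Proof. by move=> mB; rewrite /events src_workers; exists B => //; rewrite setTI. Qed.

Lemma measurable_coin_past t m : (4 * t < m)%N ->
  measurable_fun [set: U m] (coin r t : U m -> bool).
Proof.
move=> tm _ B _; rewrite setTI.
exact: (measurable_past events_setT tm (coin_event t B)).
Qed.

Lemma measurable_subset_past t m B : (4 * t + 1 < m)%N ->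
  measurable ((round_subset r t : U m -> {set 'I_d}) @^-1` [set B]).
Proof. by move=> tm; exact: (measurable_past events_setT tm (subset_event t [set B])). Qed.

Lemma measurable_server_past t m : (4 * t + 2 < m)%N ->
  measurable_fun [set: U m] (sseed r t : U m -> XS).
Proof.
move=> tm _ B mB; rewrite setTI.
exact: (measurable_past events_setT tm (server_event t mB)).
Qed.

Lemma measurable_workers_past t m : (4 * t + 3 < m)%N ->
  measurable_fun [set: U m] (wseed r t : U m -> XW).
Proof.
move=> tm _ B mB; rewrite setTI.
exact: (measurable_past events_setT tm (workers_event t mB)).
Qed.

Lemma measurable_map_joint (dX dY : measure_display) (X : measurableType dX)
    (Y : measurableType dY) (w : X -> Y) (C : Y -> 'rV[R]_d -> 'rV[R]_d) :
  measurable_fun [set: X] w -> jointly_measurable C ->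
  measurable_map (fun x => C (w x)).
Proof.
move=> mw mC y my j.
have -> : (fun x => C (w x) (y x) ord0 j) = (fun z : Y * d.-tuple R =>
    C z.1 (\row_l tnth z.2 l) ord0 j) \o (fun x => (w x, [tuple y x ord0 l | l < d])).
  apply/funext => x /=; congr (C _ _ _ _).
  by apply/rowP => l; rewrite mxE tnth_mktuple.
apply: measurableT_comp; first exact: mC.
apply: measurable_fun_pair => //; apply/measurable_fun_tnthP => l.
rewrite (_ : _ \o _ = fun x => y x ord0 l); first exact: my.
by apply/funext => x /=; rewrite tnth_mktuple.
Qed.

Lemma smeasurable_comp (dX dY : measure_display) (X : measurableType dX)
    (Y : measurableType dY) (w : X -> Y) (Z : Y -> state R n d) :
  measurable_fun [set: X] w -> smeasurable Z -> smeasurable (fun x => Z (w x)).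
Proof.
move=> mw [[H1 H2 H3] H4 H5 H6].
have C (y : Y -> 'rV[R]_d) : vmeasurable y -> vmeasurable (fun x => y (w x)).
  by move=> my j; exact: (measurableT_comp (my j) mw).
split; first split.
- by move=> i; exact: C (H1 i).
- exact: C H2.
- exact: C H3.
- by move=> i; exact: C (H4 i).
- exact: C H5.
- exact: C H6.
Qed.

Variables (f : 'I_n -> 'rV[R]_d -> R) (fs g : 'rV[R]_d -> R).
Variables (L gamma eta eta_y rho rho_y : R) (p : nat -> R) (k : nat) (z0 : state R n d).
Hypotheses (f_smooth : forall i, smooth L (f i)) (fs_smooth : smooth L fs)
    (g_smooth : smooth L g).

Let Z := bicolor f fs g gamma eta eta_y rho rho_y p k r z0.

(** The state at time [t] is a function of the four sources of each earlier round, that is, of the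
    first [4 * t] ones. *)
Lemma smeasurable_past t m : (4 * t <= m)%N ->
  smeasurable (fun s : U m => Z t s).
Proof.
elim: t => [_|t IH tm].
  split; [split| | |] => *; exact: vmeasurable_cst.
have [_ _ _ _ mmap] := r_meas.
apply: (@smeasurable_step _ _ _ _ _ _ f fs g L gamma eta eta_y rho rho_y _
  f_smooth fs_smooth g_smooth (fun s : U m => Z t s) (coin r t) (round_subset r t)
  (fun s B i => wmap r t i B (wseed r t s)) (fun s B => smap r t B (sseed r t s))).
- by apply: IH; lia.
- by apply: measurable_coin_past; lia.
- by move=> B; apply: measurable_subset_past; lia.
- move=> B i; apply: measurable_map_joint; last exact: (mmap t B).1.
  by apply: measurable_workers_past; lia.
- move=> B; apply: measurable_map_joint; last exact: (mmap t B).2.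
  by apply: measurable_server_past; lia.
Qed.

End Sources.

(** * Expected decrease in one round *)

Section OneStep.
Context {R : realType} {n d k : nat}.
Hypotheses (n_gt0 : (0 < n)%N) (d_gt0 : (0 < d)%N) (k_gt0 : (0 < k)%N)
    (k_le_d : (k <= d)%N).
Variables (mu L : R).
Hypotheses (mu_le_L : mu <= L).
Variables (f : 'I_n -> 'rV[R]_d -> R) (fs g : 'rV[R]_d -> R).
Hypotheses (f_smooth : forall i, smooth L (f i)) (fs_smooth : smooth L fs)
    (g_smooth : smooth L g)
    (f_convex : forall i, strongly_convex mu (f i))
    (fs_convex : strongly_convex mu fs) (g_convex : strongly_convex mu g).
Variable xstar : 'rV[R]_d.
Hypothesis stationary : n%:R^-1 *: (\sum_(i < n) gradient (f i) xstar)
  + 2 *: gradient fs xstar + gradient g xstar = 0.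
Context {dT dW dS : measure_display} {T : measurableType dT}
    {XW : measurableType dW} {XS : measurableType dS}.
Variables (P : probability T R) (r : randomness R n d T XW XS)
    (omega omega_s omega_av : R).
Hypotheses (omega_ge0 : 0 <= omega) (omega_s_ge0 : 0 <= omega_s)
    (omega_av_ge0 : 0 <= omega_av).
Variables (gamma eta rho p : R).
Hypotheses (gamma_gt0 : 0 < gamma) (p_gt0 : 0 < p) (p_le1 : p <= 1)
    (eta_gt0 : 0 < eta)
    (rhoE : rho * (2 + omega_av + 2 * omega_s) = 1)
    (etaE : eta * (1 + 2 * omega + 2 * omega_s) = rho)
    (r_meas : measurable_randomness r)
    (r_sampling : sampling_assumption P r (fun=> p) k)
    (r_indep : independence_assumption P r)
    (r_comp : compressor_assumption P r omega omega_s omega_av).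
Variable z0 : state R n d.
Hypothesis z0_init : dual_balanced z0.

Let Z := bicolor f fs g gamma eta eta rho rho (fun=> p) k r z0.
Let Psi := lyapunov f g gamma eta p k xstar.
Let step := bicolor_step f fs g gamma eta eta rho rho k p.
Let W : R := d%:R ^+ 2 * gamma / (p ^+ 2 * k%:R ^+ 2 * eta).
Let kappa : R := p * k%:R / (d%:R * gamma) * eta.
Let tau : R := p * k%:R / d%:R.
Let U := pastType (events r).
(** Stands for uncompressed worker messages, which replace the random ones once these are averaged
    out at the price of a noise term. *)
Let idw : 'I_n -> 'rV[R]_d -> 'rV[R]_d := fun _ x => x.

Let wg (A : {set 'I_d}) (z : state R n d) (i : 'I_n) :=
  gap A (hatw f gamma z i) (haty g gamma z).
Let sg (A : {set 'I_d}) (z : state R n d) := gap A (hats fs gamma z) (haty g gamma z).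
Let aw : R := gamma^-1 * (rho ^+ 2 * omega_av / 2) + W * kappa ^+ 2 * omega.
Let as_ : R := 2 * n%:R * omega_s * (gamma^-1 * rho ^+ 2 + W * kappa ^+ 2).
Let value := step_value (k := k) f fs g gamma eta rho p xstar.

Let Psi_ge0 z : 0 <= Psi z.
Proof. exact: lyapunov_ge0. Qed.

Let W_ge0 : 0 <= W.
Proof. exact/ltW/lyapunov_coef_gt0. Qed.

Let aw_ge0 : 0 <= aw.
Proof.
have gi0 : 0 <= gamma^-1 by rewrite invr_ge0 ltW.
apply: addr_ge0; apply: mulr_ge0 => //.
- by apply: divr_ge0 => //; apply: mulr_ge0 => //; exact: sqr_ge0.
- by apply: (mulr_ge0 W_ge0); exact: sqr_ge0.
Qed.

Let as_ge0 : 0 <= as_.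
Proof.
have gi0 : 0 <= gamma^-1 by rewrite invr_ge0 ltW.
apply: mulr_ge0; first by do 2 apply: mulr_ge0 => //.
by apply: addr_ge0; [apply: (mulr_ge0 gi0)|apply: (mulr_ge0 W_ge0)]; exact: sqr_ge0.
Qed.

Let sum_wg_ge0 A z : 0 <= \sum_i sqnorm (wg A z i).
Proof. by apply: sumr_ge0 => i _; exact: sqnorm_ge0. Qed.

Lemma mean_le_integral (X : T -> R) c : mean_le P X c ->
  (\int[P]_s (X s)%:E <= c%:E)%E.
Proof. by move=> [v [_ ->] vc]; rewrite lee_fin. Qed.

Lemma bicolor_balanced t s : dual_balanced (Z t s).
Proof. by elim: t => [//|t IH]; exact: dual_balanced_step. Qed.

Let vm_wcomp t i A x : vmeasurable (fun s => wcomp r t i A s x).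
Proof.
have [_ _ mw _ mmap] := r_meas.
by apply: (measurable_map_joint (mw t) ((mmap t A).1 i)) => j; exact: measurable_cst.
Qed.

Let vm_scomp t A x : vmeasurable (fun s => scomp r t A s x).
Proof.
have [_ _ _ ms mmap] := r_meas.
by apply: (measurable_map_joint (ms t) (mmap t A).2) => j; exact: measurable_cst.
Qed.

Lemma workers_mean t A z cs :
  (\int[P]_s (value A z (fun i => wcomp r t i A s (wg A z i)) cs)%:E
   <= (value A z (wg A z) cs + aw * \sum_i sqnorm (wg A z i))%:E)%E.
Proof.
have [cw _ cav] := r_comp t A.
apply: mean_le_integral; apply: mean_round_value_workers => //.
- exact: ltW.
- move=> i j; have [_ E _] := cw i _ (@gap_supported _ _ A (hatw f gamma z i) (haty g gamma z)).
  by have := E j; rewrite unlock.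
- move=> i; have [_ _] := cw i _ (@gap_supported _ _ A (hatw f gamma z i) (haty g gamma z)).
  by rewrite unlock.
- have := cav (wg A z) (fun i => @gap_supported _ _ A (hatw f gamma z i) (haty g gamma z)).
  by rewrite unlock.
Qed.

Lemma server_mean t A z cw :
  mean_le P (fun s => value A z cw (scomp r t A s (sg A z)))
    (value A z cw (sg A z) + as_ * sqnorm (sg A z)).
Proof.
have [_ cs _] := r_comp t A.
have [_ E V] := cs _ (@gap_supported _ _ A (hats fs gamma z) (haty g gamma z)).
apply: mean_round_value_server => //.
- exact: ltW.
- by move=> j; have := E j; rewrite unlock.
- by move: V; rewrite unlock.
Qed.

Lemma wcomp_supported t i A s z : supported A (wcomp r t i A s (wg A z i)).
Proof.
have [cw _ _] := r_comp t A.
have [H _ _] := cw i _ (@gap_supported _ _ A (hatw f gamma z i) (haty g gamma z)).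
exact: H.
Qed.

Lemma scomp_supported t A s z : supported A (scomp r t A s (sg A z)).
Proof.
have [_ cs _] := r_comp t A.
have [H _ _] := cs _ (@gap_supported _ _ A (hats fs gamma z) (haty g gamma z)).
exact: H.
Qed.

Lemma wg_supported A z i : supported A (wg A z i).
Proof. exact: gap_supported. Qed.

(* What remains of one step after averaging over the workers' messages. *)
Let after_workers (theta : bool) A (Cs : 'rV[R]_d -> 'rV[R]_d) z : R :=
  Psi (step theta A idw Cs z)
  + (if theta then aw * \sum_i sqnorm (wg A z i) else 0).

(* What remains after averaging over the server's message as well. *)
Let after_server (theta : bool) A z : R :=
  Psi (step false A idw id z)
  - (if theta then 2 / tau * \sum_(j in A) pairing f fs g gamma xstar z j else 0).

Let after_workers_ge0 theta A Cs z : 0 <= after_workers theta A Cs z.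
Proof. by rewrite addr_ge0//; case: theta => //; rewrite mulr_ge0. Qed.

Let workers_le t theta A s z :
  (\int[P]_w (Psi (step theta A (fun i => wcomp r t i A w) (scomp r t A s) z))%:E
   <= (after_workers theta A (scomp r t A s) z)%:E)%E.
Proof.
rewrite /after_workers; case: theta; last first.
  by rewrite addr0; exact: (mean_le_integral (mean_le_cst P (Psi (step false A idw id z)))).
rewrite [Psi (step _ _ idw _ _)](@lyapunov_step R n d k f fs g gamma eta rho p xstar
   A z idw (scomp r t A s)) => [||]; last 2 first.
- by move=> i; exact: wg_supported.
- exact: scomp_supported.
apply: le_trans (workers_mean t A z _).
rewrite le_eqVlt; apply/orP; left; apply/eqP; apply: eq_integral => w _.
congr (_%:E); apply: (@lyapunov_step R n d k f fs g gamma eta rho p xstar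
   A z (fun i => wcomp r t i A w) (scomp r t A s)).
- by move=> i; exact: wcomp_supported.
- exact: scomp_supported.
Qed.

Let server_le t theta A z : dual_balanced z ->
  (\int[P]_s (after_workers theta A (scomp r t A s) z)%:E
   <= (after_server theta A z)%:E)%E.
Proof.
move=> bal; rewrite /after_workers /after_server; case: theta; last first.
  under eq_integral do rewrite addr0.
  rewrite subr0.
  by exact: (mean_le_integral (mean_le_cst P (Psi (step false A idw id z)))).
have := step_value_le n_gt0 d_gt0 k_gt0 gamma_gt0 p_gt0 eta_gt0 stationary A
  omega_ge0 omega_s_ge0 omega_av_ge0 rhoE etaE bal.
rewrite -/W -/kappa -/tau -/value -/aw -/as_ -/Psi -/step => le.
apply: (@le_trans _ _ (value A z (wg A z) (sg A z) + as_ * sqnorm (sg A z)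
   + aw * \sum_i sqnorm (wg A z i))%:E); last first.
  by rewrite lee_fin addrAC.
have -> : (fun s => (Psi (step true A idw (scomp r t A s) z)
     + aw * \sum_i sqnorm (wg A z i))%:E)
   = (fun s => (value A z (wg A z) (scomp r t A s (sg A z))
     + aw * \sum_i sqnorm (wg A z i))%:E).
  apply/funext => s; congr (_ + _)%:E.
  apply: (@lyapunov_step R n d k f fs g gamma eta rho p xstar
     A z idw (scomp r t A s)) => [i|]; first exact: wg_supported.
  exact: scomp_supported.
apply: mean_le_integral; apply: mean_leD; first exact: server_mean.
exact: mean_le_cst.
Qed.

(** A difference without evident sign; by [server_le] it dominates the integral of a nonnegative
    function. The bound is the same in every round, and round 0 serves as witness. *)
Let after_server_ge0 theta A z : dual_balanced z -> 0 <= after_server theta A z.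
Proof.
move=> bal; rewrite -lee_fin; apply: le_trans (server_le 0 theta A bal).
by apply: integral_ge0 => s _; rewrite lee_fin.
Qed.

(** Here [2 / tau * (k / d) = 2 / p]; the coin then turns this into the factor 2 of
    [local_step_le]. *)
Let average_subset (theta : bool) z :
  \sum_A subset_weight (k := k) A * after_server theta A z
  = Psi (step false finset.set0 idw id z)
    - (if theta then 2 / p * \sum_j pairing f fs g gamma xstar z j else 0).
Proof.
have E A : subset_weight (k := k) A * after_server theta A z =
   subset_weight (k := k) A * Psi (step false finset.set0 idw id z)
   - subset_weight (k := k) A *
     (if theta then 2 / tau * \sum_(j in A) pairing f fs g gamma xstar z j else 0).
  by rewrite mulrBr.
under eq_bigr do rewrite E.
rewrite sumrB -mulr_suml subset_weight_sum1// mul1r; congr (_ - _).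
case: theta {E}; last by rewrite big1// => A _; rewrite mulr0.
under eq_bigr do rewrite mulrCA.
rewrite -mulr_sumr subset_weight_mem// mulrA; congr (_ * _).
have d0 : d%:R != 0 :> R by rewrite pnatr_eq0 -lt0n.
have k0 : k%:R != 0 :> R by rewrite pnatr_eq0 -lt0n.
have p0 : p != 0 by rewrite gt_eqF.
by rewrite /tau; field; rewrite k0 d0 p0.
Qed.

Definition coin_weight (b : bool) : R := if b then p else 1 - p.

Let average_coin z : dual_balanced z ->
  \sum_b coin_weight b * (\sum_A subset_weight (k := k) A * after_server b A z)
  <= rate (d := d) gamma mu L eta p k * Psi z.
Proof.
move=> bal; rewrite big_bool/= !average_subset.
have := local_step_le rho xstar n_gt0 d_gt0 k_gt0 gamma_gt0 p_gt0 eta_gt0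
  mu_le_L f_smooth fs_smooth g_smooth f_convex fs_convex g_convex finset.set0 z.
apply: le_trans; rewrite -/Psi -/step -/idw.
move: (Psi (step _ _ _ _ _)) (\sum_j _) => a b.
rewrite le_eqVlt; apply/orP; left; apply/eqP.
by field; rewrite gt_eqF.
Qed.

Let coin_prob t b : P (coin r t @^-1` [set b]) = (coin_weight b)%:E.
Proof.
have Pt := r_sampling.1 t; case: b => //=.
have [mc _ _ _ _] := r_meas.
have -> : coin r t @^-1` [set false] = ~` (coin r t @^-1` [set true]).
  by apply/seteqP; split=> s /=; case: (coin r t s).
rewrite probability_setC ?Pt//.
by rewrite -[X in measurable X]setTI; exact: mc.
Qed.

Section Measurability.
Context {dX : measure_display} {X : measurableType dX}.
Variables (theta : X -> bool) (A : X -> {set 'I_d}) (z : X -> state R n d).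
Hypotheses (mtheta : measurable_fun [set: X] theta)
  (mA : forall B, measurable (A @^-1` [set B])) (mz : smeasurable z).

Let mhw i : vmeasurable (fun x => hatw f gamma (z x) i).
Proof. by have [[Hx _ _] Hu _ _] := mz; exact: (vmeasurable_hat _ (f_smooth i) (Hx i) (Hu i)). Qed.

Let mhs : vmeasurable (fun x => hats fs gamma (z x)).
Proof. by have [[_ Hx _] _ Hu _] := mz; exact: (vmeasurable_hat _ fs_smooth Hx Hu). Qed.

Let mhy : vmeasurable (fun x => haty g gamma (z x)).
Proof. by have [[_ _ Hx] _ _ Hu] := mz; exact: (vmeasurable_hat _ g_smooth Hx Hu). Qed.

Lemma measurable_after_workers (Cs : X -> {set 'I_d} -> 'rV[R]_d -> 'rV[R]_d) :
  (forall B, measurable_map (fun x => Cs x B)) ->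
  measurable_fun [set: X] (fun x => after_workers (theta x) (A x) (Cs x (A x)) (z x)).
Proof.
move=> mCs; apply: measurable_funD.
  apply: measurable_lyapunov.
  exact: (@smeasurable_step R n d k dX X f fs g L gamma eta eta rho rho p
    f_smooth fs_smooth g_smooth z theta A (fun _ _ => idw) Cs mz mtheta mA
    (fun B i y my => my) mCs).
apply: measurable_fun_ifT => //.
apply: (measurable_finite_index (a := A)
  (h := fun B x => aw * \sum_i sqnorm (wg B (z x) i))) => // B.
apply: measurable_funM => //; apply: measurable_sum => i.
by apply: measurable_sqnorm; exact: (vmeasurable_gap B (mhw i) mhy).
Qed.

Lemma measurable_pairing j :
  measurable_fun [set: X] (fun x => pairing f fs g gamma xstar (z x) j).
Proof.
have [[Hx Hs Hy] Hu Hus Huy] := mz.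
have M (a b : X -> 'rV[R]_d) ca cb : vmeasurable a -> vmeasurable b ->
    measurable_fun [set: X] (fun x => (a x - ca) ord0 j * (b x - cb) ord0 j).
  move=> ma mb; apply: measurable_funM.
    exact: (vmeasurableB ma (vmeasurable_cst ca)).
  exact: (vmeasurableB mb (vmeasurable_cst cb)).
apply: measurable_funD; last by apply: measurable_funM => //; exact: M.
apply: measurable_funD; last by apply: measurable_funM => //; exact: M.
by apply: measurable_sum => i; exact: M.
Qed.

Lemma measurable_after_server :
  measurable_fun [set: X] (fun x => after_server (theta x) (A x) (z x)).
Proof.
apply: measurable_funB.
  apply: measurable_lyapunov.
  exact: (@smeasurable_step R n d k dX X f fs g L gamma eta eta rho rho p
    f_smooth fs_smooth g_smooth z (fun=> false) A (fun _ _ => idw) (fun _ _ => id)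
    mz (measurable_cst false) mA (fun B i y my => my) (fun B y my => my)).
apply: measurable_fun_ifT => //.
apply: (measurable_finite_index (a := A)
  (h := fun B x => 2 / tau * \sum_(j in B) pairing f fs g gamma xstar (z x) j)) => // B.
apply: measurable_funM => //.
under eq_fun do rewrite big_mkcond/=.
apply: measurable_sum => j; case: (j \in B) => //; exact: measurable_pairing.
Qed.

End Measurability.

Lemma integral_lyapunov_step t :
  (\int[P]_s (Psi (Z t.+1 s))%:E
   <= (rate (d := d) gamma mu L eta p k)%:E * \int[P]_s (Psi (Z t s))%:E)%E.
Proof.
have [mc mA mw ms mmap] := r_meas.
have indep := events_indep r_indep.
have Em := events_measurable r_meas.
have ET := @events_setT _ _ _ _ _ _ _ _ _ r.
have EC := @events_setC _ _ _ _ _ _ _ _ _ r.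
have EI := @events_setI _ _ _ _ _ _ _ _ _ r.
have mZ m : (4 * t <= m)%N -> smeasurable (fun s : U m => Z t s).
  by move=> tm; exact: (@smeasurable_past R n d dT dW dS T XW XS r r_meas f fs g L
    gamma eta eta rho rho (fun=> p) k z0 f_smooth fs_smooth g_smooth t m tm).
have mid m : measurable_fun [set: T] (fun s => s : U m).
  exact: (measurable_id_past Em).
have mZT : smeasurable (fun s : T => Z t s).
  exact: (smeasurable_comp (mid _) (mZ _ (leqnn _))).
have fstA (m : nat) (dV : measure_display) (V : measurableType dV) B :
    (4 * t + 1 < m)%N ->
    measurable ((fun q : U m * V => round_subset r t q.1) @^-1` [set B]).
  move=> tm; rewrite -[X in measurable X]setTI.
  have H := (@measurable_fst _ _ (U m) V measurableT
    ((round_subset r t : U m -> {set 'I_d}) @^-1` [set B])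
    (measurable_subset_past (r := r) B tm)).
  exact H.
have fstc (m : nat) (dV : measure_display) (V : measurableType dV) :
    (4 * t < m)%N -> measurable_fun [set: U m * V] (fun q => coin r t q.1).
  move=> tm; exact: (measurableT_comp (measurable_coin_past (r := r) tm) measurable_fst).
have fstZ (m : nat) (dV : measure_display) (V : measurableType dV) :
    (4 * t <= m)%N -> smeasurable (fun q : U m * V => Z t q.1).
  move=> tm; exact: (smeasurable_comp measurable_fst (mZ m tm)).
have Z3 : (4 * t <= 4 * t + 3)%N by exact: leq_addr.
have Z2 : (4 * t <= 4 * t + 2)%N by exact: leq_addr.
have Z1 : (4 * t <= 4 * t + 1)%N by exact: leq_addr.
have c3 : (4 * t < 4 * t + 3)%N by rewrite -{1}[(4 * t)%N]addn0 ltn_add2l.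
have c2 : (4 * t < 4 * t + 2)%N by rewrite -{1}[(4 * t)%N]addn0 ltn_add2l.
have c1 : (4 * t < 4 * t + 1)%N by rewrite -{1}[(4 * t)%N]addn0 ltn_add2l.
have A3 : (4 * t + 1 < 4 * t + 3)%N by rewrite ltn_add2l.
have A2 : (4 * t + 1 < 4 * t + 2)%N by rewrite ltn_add2l.
have S3 : (4 * t + 2 < 4 * t + 3)%N by rewrite ltn_add2l.
(* The sources below [4 * t + 3] include the coin, the subset and the server seed of round [t]; only
   the workers' seed, the second component, is fresh. *)
pose F3 (q : U (4 * t + 3) * XW) : \bar R := (Psi (step (coin r t q.1)
  (round_subset r t q.1) (fun i => wmap r t i (round_subset r t q.1) q.2)
  (scomp r t (round_subset r t q.1) q.1) (Z t q.1)))%:E.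
have mF3 : measurable_fun setT F3.
  apply/measurable_EFinP; apply: measurable_lyapunov.
  apply: (@smeasurable_step R n d k _ _ f fs g L gamma eta eta rho rho p
    f_smooth fs_smooth g_smooth (fun q : U (4 * t + 3) * XW => Z t q.1)
    (fun q => coin r t q.1) (fun q => round_subset r t q.1)
    (fun q B i => wmap r t i B q.2) (fun q B => scomp r t B q.1)).
  - exact: (fstZ _ _ XW Z3).
  - exact: (fstc _ _ XW c3).
  - exact: (fun B => fstA _ _ XW B A3).
  - exact: (fun B i => measurable_map_joint measurable_snd ((mmap t B).1 i)).
  - exact: (fun B => measurable_map_joint (measurableT_comp
      (measurable_server_past (r := r) S3) measurable_fst) (mmap t B).2).
pose F2 (q : U (4 * t + 2) * XS) : \bar R := (after_workers (coin r t q.1)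
  (round_subset r t q.1) (smap r t (round_subset r t q.1) q.2) (Z t q.1))%:E.
have mF2 : measurable_fun setT F2.
  apply/measurable_EFinP.
  exact: (@measurable_after_workers _ _ _ _ _ (fstc _ _ XS c2)
    (fun B => fstA _ _ XS B A2) (fstZ _ _ XS Z2) (fun q B => smap r t B q.2)
    (fun B => measurable_map_joint measurable_snd (mmap t B).2)).
pose G2 (s : T) : \bar R :=
  (after_server (coin r t s) (round_subset r t s) (Z t s))%:E.
have mG2 : measurable_fun setT G2.
  by apply/measurable_EFinP; exact: measurable_after_server.
have step1 : (\int[P]_s F3 (s, wseed r t s) <= \int[P]_s F2 (s, sseed r t s))%E.
  apply: (decoupling_le Em ET EI indep (mw t) _ mF3).
  - by move=> N mN; exact: workers_event.
  - by move=> q; rewrite lee_fin.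
  - exact: (measurableT_comp mF2 (measurable_fun_pair (mid _) (ms t))).
  - by move=> s; exact (workers_le t (coin r t s) (round_subset r t s) s (Z t s)).
have step2 : (\int[P]_s F2 (s, sseed r t s) <= \int[P]_s G2 s)%E.
  apply: (decoupling_le Em ET EI indep (ms t) _ mF2) => //.
  - by move=> N mN; exact: server_event.
  - by move=> q; rewrite lee_fin.
  - move=> s; exact (server_le t (coin r t s) (round_subset r t s)
      (bicolor_balanced t s)).
apply: (le_trans step1); apply: (le_trans step2).
(* The subset is averaged while the coin, of index [4 * t], still belongs to the past; the coin
   follows. *)
rewrite /G2 (integral_finite_source Em ET EC EI indep (m := 4 * t + 1)
  (a := round_subset r t) (w := subset_weight (k := k))
  (H := fun B (s : U (4 * t + 1)) => after_server (coin r t s) B (Z t s))); last 4 first.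
- by move=> B; exact: subset_event.
- by move=> B; rewrite r_sampling.2.
- move=> B; apply: (measurable_after_server (A := fun=> B)).
  + exact: (measurable_coin_past (r := r) c1).
  + by move=> C; rewrite preimage_cst; case: ifP => _; [exact: measurableT|exact: measurable0].
  + exact: (mZ _ Z1).
- by move=> B s; apply: after_server_ge0; exact: bicolor_balanced.
rewrite (integral_finite_source Em ET EC EI indep (m := 4 * t)
  (a := coin r t) (w := coin_weight)
  (H := fun b (s : U (4 * t)) => \sum_B subset_weight (k := k) B * after_server b B (Z t s)));
  last 4 first.
- by move=> b; exact: coin_event.
- exact: coin_prob.
- move=> b; apply: measurable_sum => B; apply: measurable_funM => //.
  apply: (measurable_after_server (theta := fun=> b) (A := fun=> B)) => //.
  + by move=> C; rewrite preimage_cst; case: ifP => _; [exact: measurableT|exact: measurable0].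
  + exact: (mZ _ (leqnn _)).
- move=> b s; apply: sumr_ge0 => B _; rewrite mulr_ge0//.
    by rewrite /subset_weight; case: ifP.
  by apply: after_server_ge0; exact: bicolor_balanced.
have mPsi : measurable_fun [set: T] (fun s => Psi (Z t s)).
  exact: measurable_lyapunov.
have rate0 : 0 <= rate (d := d) gamma mu L eta p k.
  by rewrite /rate !le_max sqr_ge0.
rewrite -ge0_integralZl_EFin//; last 2 first.
- by move=> s _; rewrite lee_fin.
- exact/measurable_EFinP.
apply: ge0_le_integral => //.
- move=> s _; rewrite lee_fin; apply: sumr_ge0 => b _; apply: mulr_ge0.
    by rewrite /coin_weight; case: b; [exact: ltW|rewrite subr_ge0].
  apply: sumr_ge0 => B _; rewrite mulr_ge0//.
    by rewrite /subset_weight; case: ifP.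
  by apply: after_server_ge0; exact: bicolor_balanced.
- apply/measurable_EFinP; apply: measurable_sum => b; apply: measurable_funM => //.
  apply: measurable_sum => B; apply: measurable_funM => //.
  apply: (measurable_after_server (theta := fun=> b) (A := fun=> B)) => //.
  by move=> C; rewrite preimage_cst; case: ifP => _; [exact: measurableT|exact: measurable0].
- by apply/measurable_EFinP; apply: measurable_funM.
- by move=> s _; rewrite lee_fin; apply: average_coin; exact: bicolor_balanced.
Qed.

End OneStep.

(** * Optimality condition and convergence *)

Lemma stationary_of_min (R : realType) (n d : nat) (L : R)
    (f : 'I_n -> 'rV[R]_d -> R) (fs g : 'rV[R]_d -> R) (x : 'rV[R]_d) :
  (0 < n)%N -> (forall i, smooth L (f i)) -> smooth L fs -> smooth L g ->
  (forall y, objective f fs g x <= objective f fs g y) ->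
  n%:R^-1 *: (\sum_(i < n) gradient (f i) x)
    + 2 *: gradient fs x + gradient g x = 0.
Proof.
move=> n0 Lf Lfs Lg xmin; set w := LHS.
have N0 : 0 < n%:R :> R by rewrite ltr0n.
have Ni0 : 0 <= n%:R^-1 :> R by rewrite invr_ge0 ltW.
(* The quadratic upper bounds, with total weight [1 + 2 + 1 = 4], give [4 * (L / 2) = 2 * L]. Taking
   [v = - t w] and letting [t] tend to 0 then forces [w = 0]. *)
have bound v : 0 <= dotp w v + 2 * L * sqnorm v.
  have := xmin (x + v).
  have Hf : \sum_i f i (x + v)
      <= \sum_i (f i x + dotp (gradient (f i) x) v + L / 2 * sqnorm v).
    by apply: ler_sum => i _; exact (smooth_upper (Lf i) x v).
  have := ler_wpM2l Ni0 Hf; have := smooth_upper Lfs x v; have := smooth_upper Lg x v.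
  have sumc (c : R) : \sum_(i < n) c = n%:R * c.
    by rewrite sumr_const card_ord mulr_natl.
  rewrite /objective big_split/= big_split/= sumc.
  have -> : dotp w v = n%:R^-1 * (\sum_i dotp (gradient (f i) x) v)
      + 2 * dotp (gradient fs x) v + dotp (gradient g x) v.
    rewrite /w !dotpDl !dotpZl; congr (_ * _ + _ + _).
    rewrite /dotp exchange_big/=; apply: eq_bigr => j _.
    by rewrite summxE mulr_suml.
  rewrite !mulrDr (mulKf (lt0r_neq0 N0)); lra.
apply: sqnorm_eq0; apply/eqP; rewrite eq_le sqnorm_ge0 andbT.
apply: (@le_of_forall_small _ _ _ (2 * L * sqnorm w)) => t t0 _.
have := bound (- (t *: w)); rewrite sqnormN sqnormZ dotpNr dotpZr dotpp.
move=> H; rewrite add0r -(ler_pM2l t0); lra.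
Qed.

Lemma cvg_of_sqnorm (R : realType) (d : nat) (u : nat -> 'rV[R]_d)
    (l : 'rV[R]_d) (K : R) (y : nat -> R) :
  (forall t, sqnorm (u t - l) <= K * y t) -> y t @[t --> \oo] --> (0 : R) ->
  u t @[t --> \oo] --> l.
Proof.
move=> uy y0; apply/(@pseudometric_normed_Zmodule.cvgrPdist_le R) => e e0.
have Ky : K * y t @[t --> \oo] --> (0 : R).
  by rewrite -(mulr0 K); apply: cvgM => //; exact: cvg_cst.
near=> t.
rewrite [leLHS]/Num.norm /= mx_normrE; apply: bigmax_le; first exact: ltW.
move=> [i j] _ /=; rewrite ord1 -normrN.
have -> : - (l - u t) 0 j = (u t - l) ord0 j by rewrite !mxE; ring.
apply: le_trans (coord_le_enorm _ _) _.
rewrite -(@ler_pXn2r _ 2)// ?nnegrE ?enorm_ge0 ?(ltW e0)// sqr_enorm.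
apply: le_trans (uy t) _; apply: le_trans (ler_norm _) _.
rewrite -normrN -[- (_ * _)]add0r; near: t.
apply: pseudometric_normed_Zmodule.cvgr_dist_le => //.
by rewrite exprn_gt0.
Unshelve. all: by end_near. Qed.

Lemma ae_cvg0_geometric (R : realType) (dT : measure_display)
    (T : measurableType dT) (P : probability T R) (X : nat -> T -> R) (c C : R) :
  (forall t, measurable_fun [set: T] (X t)) -> (forall t s, 0 <= X t s) ->
  0 <= c -> c < 1 ->
  (forall t, (\int[P]_s (X t s)%:E <= (c ^+ t * C)%:E)%E) ->
  {ae P, forall s, X t s @[t --> \oo] --> (0 : R)}.
Proof.
move=> mX X0 c0 c1 XC.
have mXe t : measurable_fun [set: T] (fun s => (X t s)%:E) by exact/measurable_EFinP.
have X0e t s : (0 <= (X t s)%:E)%E by rewrite lee_fin.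
have C0 : 0 <= C.
  rewrite -lee_fin -[C]mul1r -[X in X * C](expr0 c); apply: le_trans (XC 0%N).
  by apply: integral_ge0 => s _.
pose S s := (\sum_(0 <= t <oo) (X t s)%:E)%E.
have S0 s : (0 <= S s)%E by apply: nneseries_ge0.
have mS : measurable_fun [set: T] S.
  exact: (ge0_emeasurable_sum (P := xpredT) (fun t s _ _ => X0e t s) (fun t _ => mXe t)).
have intS : (\int[P]_s S s <= (C / (1 - c))%:E)%E.
  rewrite /S integral_nneseries//.
  apply: lime_le.
    by apply: is_cvg_nneseries => t _ _; exact: integral_ge0.
  apply: nearW => m; rewrite big_mkord.
  apply: (@le_trans _ _ (\sum_(t < m) (c ^+ t * C)%:E)%E).
    by apply: lee_sum => t _; exact: XC.
  rewrite sumEFin lee_fin -mulr_suml mulrC ler_wpM2l//.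
  rewrite -[leRHS]mul1r ler_pdivlMr ?subr_gt0//.
  have -> : (\sum_(t < m) c ^+ t) * (1 - c) = 1 - c ^+ m.
    by rewrite mulrC -[in RHS](expr1n R m) subrXX; congr (_ * _);
      apply: eq_bigr => t _; rewrite expr1n mul1r.
  by rewrite gerBl exprn_ge0.
have iS : P.-integrable [set: T] S.
  apply/integrableP; split => //.
  under eq_integral => s _ do rewrite gee0_abs//.
  exact: le_lt_trans intS (ltry _).
apply: filterS (integrable_ae measurableT iS) => s /(_ I) fS.
have tail := @nneseries_tail_cvg R (fun t => (X t s)%:E) xpredT.
have {tail}tail := tail _ (fun t _ => X0e t s).
have {}fS : (S s < +oo)%E by rewrite -ge0_fin_numE.
have /fine_cvgP[_ //] : ((X t s)%:E @[t --> \oo] --> (0 : R)%:E)%E.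
(* [X t s] is the first term of the tail from [t], and the tails of a finite sum of nonnegative
   terms tend to 0. *)
apply: (squeeze_cvge _ (cvg_cst _) (tail fS)).
apply: nearW => t; rewrite X0e/=.
have := @nneseries_lim_ge R (fun t => (X t s)%:E) xpredT t t.+1 (fun t _ _ => X0e t s).
by rewrite big_nat1.
Qed.

Theorem theorem4p1 (R : realType) (n d k : nat)
    (n_gt0 : (0 < n)%N) (d_gt0 : (0 < d)%N) (k_gt0 : (0 < k)%N)
    (k_le_d : (k <= d)%N)
    (mu L : R) (mu_gt0 : 0 < mu) (mu_le_L : mu <= L)
    (f : 'I_n -> 'rV[R]_d -> R) (fs g : 'rV[R]_d -> R)
    (f_smooth : forall i, smooth L (f i)) (fs_smooth : smooth L fs)
    (g_smooth : smooth L g)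
    (f_convex : forall i, strongly_convex mu (f i))
    (fs_convex : strongly_convex mu fs) (g_convex : strongly_convex mu g)
    (xstar : 'rV[R]_d)
    (xstar_min : forall x, objective f fs g xstar <= objective f fs g x)
    (dT dW dS : measure_display) (T : measurableType dT)
    (XW : measurableType dW) (XS : measurableType dS)
    (P : probability T R) (r : randomness R n d T XW XS)
    (omega omega_s omega_av : R)
    (omega_ge0 : 0 <= omega) (omega_s_ge0 : 0 <= omega_s)
    (omega_av_ge0 : 0 <= omega_av)
    (gamma eta eta_y rho rho_y p : R)
    (gamma_gt0 : 0 < gamma) (gamma_lt : gamma < 2 / L)
    (p_gt0 : 0 < p) (p_le1 : p <= 1)
    (rhoE : rho = (2 + omega_av + 2 * omega_s)^-1)
    (rho_yE : rho_y = rho)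
    (etaE : eta = ((1 + 2 * omega + 2 * omega_s)
                   * (2 + omega_av + 2 * omega_s))^-1)
    (eta_yE : eta_y = eta)
    (r_meas : measurable_randomness r)
    (r_sampling : sampling_assumption P r (fun=> p) k)
    (r_indep : independence_assumption P r)
    (r_comp : compressor_assumption P r omega omega_s omega_av)
    (z0 : state R n d)
    (z0_init :
      n%:R^-1 *: (\sum_(i < n) uw z0 i) + 2 *: us z0 + uy z0 = 0) :
  let Z := bicolor f fs g gamma eta eta_y rho rho_y (fun=> p) k r z0 in
  let Psi z := lyapunov f g gamma eta p k xstar z in
  let c := rate (d := d) gamma mu L eta p k in
  [/\ c < 1,
      forall t, ('E_P[fun s => Psi (Z t s)] <= (c ^+ t * Psi z0)%:E)%E
    & {ae P, forall s,
        [/\ forall i, xw (Z t s) i @[t --> \oo] --> xstar,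
            xs (Z t s) @[t --> \oo] --> xstar,
            yy (Z t s) @[t --> \oo] --> xstar,
            forall i, uw (Z t s) i @[t --> \oo] --> gradient (f i) xstar
          & uy (Z t s) @[t --> \oo] --> gradient g xstar]}].
Proof.
subst rho_y eta_y => Z Psi c.
have q0 : 0 < 2 + omega_av + 2 * omega_s by lra.
have q1 : 0 < 1 + 2 * omega + 2 * omega_s by lra.
have rho_eq : rho * (2 + omega_av + 2 * omega_s) = 1.
  by rewrite rhoE mulVf ?gt_eqF.
have eta_eq : eta * (1 + 2 * omega + 2 * omega_s) = rho.
  by rewrite etaE rhoE invfM mulrAC mulVf ?mul1r ?gt_eqF.
have eta_gt0 : 0 < eta by rewrite etaE invr_gt0 mulr_gt0.
have stat := stationary_of_min n_gt0 f_smooth fs_smooth g_smooth xstar_min.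
have W0 := lyapunov_coef_gt0 d_gt0 k_gt0 gamma_gt0 p_gt0 eta_gt0.
have Psi0 z : 0 <= Psi z.
  exact: (lyapunov_ge0 f g xstar d_gt0 k_gt0 gamma_gt0 p_gt0 eta_gt0).
have L0 : 0 < L by lra.
have gL : gamma * L < 2 by move: gamma_lt; rewrite ltr_pdivlMr.
have gmu : gamma * mu <= gamma * L by rewrite ler_pM2l.
have gmu0 : 0 < gamma * mu by rewrite mulr_gt0.
have c0 : 0 <= c by rewrite /c /rate !le_max sqr_ge0.
have c1 : c < 1.
  (* Applied to [gamma * mu] and [gamma * L], both strictly between 0 and 2. *)
  have sq (x : R) : 0 < x -> x < 2 -> (1 - x) ^+ 2 < 1.
    move=> x0 x2; have := mulr_gt0 x0 (_ : 0 < 2 - x); rewrite subr_gt0 x2.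
    by move=> /(_ isT); lra.
  rewrite /c /rate !gt_max !sq//=; [|lra..].
  rewrite gtrBl; apply: divr_gt0; last by rewrite exprn_gt0// ltr0n.
  by apply: mulr_gt0 => //; apply: mulr_gt0; rewrite exprn_gt0// ltr0n.
have mean t : (\int[P]_s (Psi (Z t s))%:E <= (c ^+ t * Psi z0)%:E)%E.
  elim: t => [|t IH].
    by rewrite expr0 mul1r; exact (mean_le_integral (mean_le_cst P (Psi z0))).
  apply: le_trans (integral_lyapunov_step n_gt0 d_gt0 k_gt0 k_le_d mu_le_L
    f_smooth fs_smooth g_smooth f_convex fs_convex g_convex stat
    omega_ge0 omega_s_ge0 omega_av_ge0 gamma_gt0 p_gt0 p_le1 eta_gt0 rho_eq
    eta_eq r_meas r_sampling r_indep r_comp z0_init t) _.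
  by rewrite exprS -mulrA EFinM; apply: lee_wpmul2l => //; rewrite lee_fin.
split => //.
  by move=> t; rewrite unlock; exact: mean.
have mPsi t : measurable_fun [set: T] (fun s => Psi (Z t s)).
  apply: measurable_lyapunov.
  apply: (smeasurable_comp (measurable_id_past (events_measurable r_meas) (m := 4 * t))).
  exact: (@smeasurable_past R n d dT dW dS T XW XS r r_meas f fs g L
    gamma eta eta rho rho (fun=> p) k z0 f_smooth fs_smooth g_smooth t _ (leqnn _)).
apply: filterS (ae_cvg0_geometric mPsi (fun t s => Psi0 (Z t s)) c0 c1 mean).
move=> s Hs.
have sum_ge0 (F : 'I_n -> 'rV[R]_d) : 0 <= \sum_i sqnorm (F i).
  by apply: sumr_ge0 => i _; exact: sqnorm_ge0.
have sum_ge (F : 'I_n -> 'rV[R]_d) i : sqnorm (F i) <= \sum_i sqnorm (F i).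
  by rewrite (bigD1 i)//= lerDl; apply: sumr_ge0 => j _; exact: sqnorm_ge0.
have N1 : 1 <= n%:R :> R by rewrite ler1n.
have parts z : gamma^-1 * ((\sum_(i < n) sqnorm (xw z i - xstar))
      + 2 * n%:R * sqnorm (xs z - xstar) + n%:R * sqnorm (yy z - xstar)) <= Psi z /\
    d%:R ^+ 2 * gamma / (p ^+ 2 * k%:R ^+ 2 * eta)
    * ((\sum_(i < n) sqnorm (uw z i - gradient (f i) xstar))
       + n%:R * sqnorm (uy z - gradient g xstar)) <= Psi z.
  rewrite /Psi /lyapunov; split; rewrite ?lerDl ?lerDr; apply: mulr_ge0.
  - exact: ltW.
  - by rewrite addr_ge0// mulr_ge0// sqnorm_ge0.
  - by rewrite invr_ge0 ltW.
  - by rewrite !addr_ge0// ?mulr_ge0// ?sqnorm_ge0.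
have xpart z : (\sum_(i < n) sqnorm (xw z i - xstar))
    + 2 * n%:R * sqnorm (xs z - xstar) + n%:R * sqnorm (yy z - xstar)
    <= gamma * Psi z by rewrite -ler_pdivrMl//; exact: (parts z).1.
have upart z : (\sum_(i < n) sqnorm (uw z i - gradient (f i) xstar))
    + n%:R * sqnorm (uy z - gradient g xstar)
    <= (d%:R ^+ 2 * gamma / (p ^+ 2 * k%:R ^+ 2 * eta))^-1 * Psi z.
  by rewrite ler_pdivlMl//; exact: (parts z).2.
have nsq (x : 'rV[R]_d) : sqnorm x <= n%:R * sqnorm x.
  by rewrite ler_peMl// sqnorm_ge0.
split.
- move=> i; apply: cvg_of_sqnorm Hs => t; apply: le_trans (xpart _).
  apply: le_trans (sum_ge (fun i => xw (Z t s) i - xstar) i) _.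
  by rewrite -addrA lerDl addr_ge0// mulr_ge0// ?sqnorm_ge0// mulr_ge0.
- apply: cvg_of_sqnorm Hs => t; apply: le_trans (xpart _).
  have := sum_ge0 (fun i => xw (Z t s) i - xstar).
  have := nsq (xs (Z t s) - xstar); have := sqnorm_ge0 (xs (Z t s) - xstar).
  have := nsq (yy (Z t s) - xstar); have := sqnorm_ge0 (yy (Z t s) - xstar).
  by move: (\sum_i _) (sqnorm _) (sqnorm _) => *; lra.
- apply: cvg_of_sqnorm Hs => t; apply: le_trans (xpart _).
  apply: le_trans (nsq _) _; rewrite lerDr addr_ge0//.
  by rewrite mulr_ge0// ?sqnorm_ge0// mulr_ge0.
- move=> i; apply: cvg_of_sqnorm Hs => t; apply: le_trans (upart _).
  apply: le_trans (sum_ge (fun i => uw (Z t s) i - gradient (f i) xstar) i) _.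
  by rewrite lerDl mulr_ge0// sqnorm_ge0.
- apply: cvg_of_sqnorm Hs => t; apply: le_trans (upart _).
  by apply: le_trans (nsq _) _; rewrite lerDr.
Qed.
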